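(* Let $S$ be a standard graded polynomial ring over a field $k$ and let $I\subset S$ be a homogeneous ideal generated in degree $d$ and of height $c\geq 2$. If $I$ satisfies the condition $N_{d,c}$ (i.e., the minimal graded resolution is linear up to step $c$), then $$\binom{d+t-2}{t-1}\binom{d+c-1}{c-t}\leq \beta_t(S/I)\quad\text{for } 1\leq t\leq c.$$
   Context: $\beta_i(S/I)=\dim_k\mathrm{Tor}_i^S(k,S/I)$. Write $t_i^S(N)=\sup\{j\mid \mathrm{Tor}_i^S(k,N)_j\neq0\}$. For integers $d,q\geq 1$, a homogeneous ideal $I$ satisfies the condition $N_{d,q}$ if $t_i^S(S/I)=d+i-1$ for all $1\leq i\leq q$. *)

(* Defs.v *)
From mathcomp Require Import all_boot all_algebra.
From mathcomp Require Import ring_quotient.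
From mathcomp.multinomials Require Import mpoly.

Set Implicit Arguments.
Unset Strict Implicit.
Unset Printing Implicit Defensive.

Import GRing.Theory Num.Theory.
Local Open Scope ring_scope.

Section Ideals.
Variables (k : fieldType) (n : nat).
Local Notation S := {mpoly k[n]}.

(* The library's [idealr_closed] requires an ideal to be proper. *)
Definition prime_ideal (P : {pred S}) : Prop :=
  idealr_closed P /\ prime_idealr_closed P.

Definition homogeneous_ideal (I : {pred S}) : Prop :=
  forall (f : S) (e : nat), f \in I -> pihomog mdeg e f \in I.

Definition generated_in_degree (d : nat) (I : {pred S}) : Prop :=
  forall f : S, f \in I <->
    exists s : seq (S * S),
      (forall ag, ag \in s -> ag.2 \in I /\ ag.2 \is d.-homog) /\
      f = \sum_(ag <- s) ag.1 * ag.2.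

(* There is a chain C 0 < C 1 < ... < C m = P of prime ideals. *)
Definition prime_height_ge (P : {pred S}) (m : nat) : Prop :=
  exists C : nat -> {pred S},
    [/\ forall i, (i <= m)%N -> prime_ideal (C i),
        forall i, (i < m)%N -> {subset C i <= C i.+1} /\
                               (exists2 f, f \in C i.+1 & f \notin C i)
      & C m =i P].

(* The minimum of the heights of the primes containing I equals c. *)
Definition has_height (I : {pred S}) (c : nat) : Prop :=
  (forall P : {pred S}, prime_ideal P -> {subset I <= P} ->
     prime_height_ge P c) /\
  (exists P : {pred S}, [/\ prime_ideal P, {subset I <= P},
     prime_height_ge P c & ~ prime_height_ge P c.+1]).

End Ideals.

(* A sequence ... -> F_2 -> F_1 -> F_0 of maps of finitely generated graded free
   S-modules with a map F_0 -> S.  Elements of F_i are row vectors, the l-th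
   basis element of F_i has degree [fdeg i l] (so that F_i is the direct sum of
   the S(- fdeg i l)), and maps are given by right multiplication. *)
Record graded_free_seq (k : fieldType) (n : nat) := GradedFreeSeq {
  frank : nat -> nat;
  fdeg : forall i, 'I_(frank i) -> int;
  fdiff : forall i, 'M[{mpoly k[n]}]_(frank i.+1, frank i);
  faug : 'cV[{mpoly k[n]}]_(frank 0)
}.

Section Tor.
Variables (k : fieldType) (n : nat).
Local Notation S := {mpoly k[n]}.
Variable F : graded_free_seq k n.

(* F is a graded free resolution of S/I, the augmentation F_0 -> S/I being the
   class modulo I of F_0 -> S: the maps preserve degrees, F_0 -> S/I is onto,
   and the augmented sequence is exact. *)
Definition graded_free_resolution (I : {pred S}) : Prop :=
  [/\ forall (l : 'I_(frank F 0)) (m : 'X_{1..n}),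
        m \in msupp (faug F l 0) -> fdeg l = (mdeg m)%:Z,
      forall i (r : 'I_(frank F i.+1)) (l : 'I_(frank F i)) (m : 'X_{1..n}),
        m \in msupp (fdiff F i r l) -> fdeg r = fdeg l + (mdeg m)%:Z,
      exists u : 'rV[S]_(frank F 0), (u *m faug F) 0 0 - 1 \in I,
      forall u : 'rV[S]_(frank F 0),
        (u *m faug F) 0 0 \in I <-> exists v, u = v *m fdiff F 0
    & forall i (u : 'rV[S]_(frank F i.+1)),
        u *m fdiff F i = 0 <-> exists v, u = v *m fdiff F i.+1].

(* The differential of the complex k (x)_S F, where k = S / (x_1, ..., x_n). *)
Definition kdiff (i : nat) : 'M[k]_(frank F i.+1, frank F i) :=
  map_mx (mcoeff 0%MM) (fdiff F i).

Definition kcycles (i : nat) : 'M[k]_(frank F i) :=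
  match i return 'M[k]_(frank F i) with
  | 0 => 1%:M
  | i'.+1 => kermx (kdiff i')
  end.

(* The row space of vectors of k (x)_S F_i that are homogeneous of degree j. *)
Definition kdegree (i : nat) (j : int) : 'M[k]_(frank F i) :=
  diag_mx (\row_l (@fdeg _ _ F i l == j)%:R).

(* Tor_i^S(k, S/I) is the homology (cycles modulo boundaries) of k (x)_S F for
   a graded free resolution F of S/I; [betti] is its dimension, and
   [graded_betti] that of its degree j component. *)
Definition betti (i : nat) : nat := \rank (kcycles i :\: kdiff i)%MS.

Definition graded_betti (i : nat) (j : int) : nat :=
  \rank ((kcycles i :&: kdegree i j) :\: (kdiff i :&: kdegree i j))%MS.

(* t = sup {j | Tor_i^S(k, S/I)_j != 0}.  As F_i has finite rank, the supremum
   is finite exactly when it is attained. *)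
Definition has_top_degree (i : nat) (t : int) : Prop :=
  graded_betti i t != 0%N /\
  (forall j : int, graded_betti i j != 0%N -> j <= t).

Definition condition_N (d q : nat) : Prop :=
  forall i : nat, (1 <= i <= q)%N -> has_top_degree i (d%:Z + i%:Z - 1).

End Tor.

(* Main.v *)
(* Write S = k[x_1..x_n].  The condition N_{d,c} makes the first c steps of the
   minimal resolution of S/I a linear complex M (after the generators, of degree
   d), and M_t embeds in Tor_t, so it is enough to bound the ranks of M from
   below.  After the infinite base change k -> K = k(t), the hypothesis on the
   height gives a linear map theta : S -> K[y_1..y_c] such that the image of I
   contains y_j^N for every j; since the elements of I act null-homotopically on
   M, so do the y_j^N on M' = theta(M).

   Write D_i = sum_j y_j A_{i,j} for the linear maps of M' and [D_0]_m for the
   coefficient of the monomial m in the map M'_1 -> M'_0.  The columns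
   A_{t-1,j_{t-1}} ... A_{1,j_1} [D_0]_m are alternating in j_1, ..., j_{t-1} and
   satisfy Koszul relations in (j, m).  For t = c the homotopies give a row rho,
   the top component of a map from the Koszul complex on the y_j^N to M', and
   the coefficients of rho separate these columns, which reflects the self-duality
   of K[y]/(y_1^N, ..., y_c^N).  For t < c, multiplying by the remaining A's
   reduces to t = c, and the pairing between the columns with
   j_1 < ... < j_{t-1} < max m and the resulting functionals is diagonal with
   entries +-1. *)

From HB Require Import structures.
Require Import Defs.
From mathcomp Require Import all_boot all_order all_algebra ring_quotient zify ring.
From mathcomp Require Import boolp.
From mathcomp Require classical_sets.
From mathcomp.multinomials Require Import mpoly.

Set Implicit Arguments.
Unset Strict Implicit.
Unset Printing Implicit Defensive.
Import Order.TTheory GRing.Theory Num.Theory.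

(** * Coefficient matrices *)

Section CoefficientMatrices.
Local Open Scope ring_scope.
Variables (K : comNzRingType) (c : nat).
Local Notation R := {mpoly K[c]}.
Implicit Types (m : 'X_{1..c}).

(** Substitution by theta destroys exactness, since the linear relations that cut down to c
    variables need not form a regular sequence on S/I. Matrix identities survive any ring map:
    consecutive maps compose to zero, and elements of I are null-homotopic. The bound is derived
    from these identities alone, and they hold only below the top module M_c, where no homotopy
    identity is available. The numbers in the bound are the Betti numbers of (y_1, ..., y_c)^d, and
    the columns kept are indexed by the symbols of its Eliahou-Kervaire resolution; hence the
    condition j_{t-1} < max m. Since F may fail to be minimal, M is not a subcomplex read off from
    F: it is built from bases of the lowest-degree cycles and compared with F up to homotopy. Height
    is given by chains of primes and enters through counting: growth modulo a prime limits the
    chains below it, which forces nonzero elements of I in few variables and so bounds the monomials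
    needed modulo I. The infinite field serves to pick a point off a hypersurface. *)

Definition cfmx p q (m : 'X_{1..c}) (P : 'M[R]_(p, q)) : 'M[K]_(p, q) :=
  map_mx (mcoeff m) P.

Lemma mcoeffMXle (f : R) m k :
  (f * 'X_[m])@_k = if (m <= k)%MM then f@_(k - m) else 0.
Proof.
case: ifPn => [le|nle]; first by rewrite -{1}(submK le) addmC mcoeffMX.
apply/eqP; rewrite mcoeff_eq0; apply: contra nle => /msuppM_le /allpairsP[[a b]].
by rewrite msuppX inE /= => -[_ /eqP-> ->]; apply: lem_addl.
Qed.

Lemma cfmxB p q m (P Q : 'M_(p, q)) : cfmx m (P - Q) = cfmx m P - cfmx m Q.
Proof. by apply/matrixP => i j; rewrite !mxE mcoeffB. Qed.

Lemma cfmx0 p q m : cfmx m (0 : 'M_(p, q)) = 0.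
Proof. by apply/matrixP => i j; rewrite !mxE mcoeff0. Qed.

Lemma cfmx_mulC p q r m (P : 'M_(p, q)) (Q : 'M[K]_(q, r)) :
  cfmx m (P *m map_mx (@mpolyC c K) Q) = cfmx m P *m Q.
Proof.
apply/matrixP => i j; rewrite !mxE raddf_sum; apply: eq_bigr => l _ /=.
by rewrite !mxE mulrC mcoeffCM mulrC.
Qed.

Lemma cfmx_Cmul p q r m (Q : 'M[K]_(p, q)) (P : 'M_(q, r)) :
  cfmx m (map_mx (@mpolyC c K) Q *m P) = Q *m cfmx m P.
Proof.
apply/matrixP => i j; rewrite !mxE raddf_sum; apply: eq_bigr => l _ /=.
by rewrite !mxE mcoeffCM.
Qed.

Lemma cfmx_X_scale p q m k (P : 'M_(p, q)) :
  cfmx k ('X_[m] *: P) = if (m <= k)%MM then cfmx (k - m) P else 0.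
Proof.
apply/matrixP => i j; case: ifPn => h; rewrite !mxE mulrC mcoeffMXle.
  by rewrite h.
by rewrite (negPf h).
Qed.

Definition homogmx d p q (P : 'M[R]_(p, q)) := forall i j, P i j \is d.-homog.

Lemma homog1E (f : R) : f \is 1.-homog -> f = \sum_j f@_(U_(j)) *: 'X_j.
Proof.
move=> hf; apply/mpolyP => m; rewrite raddf_sum /=.
case: (mdeg1P m) => [[i /eqP->]|hm].
  rewrite (bigD1 i) //= mcoeffZ mcoeffX eqxx mulr1 big1 ?addr0 // => j jni.
  by rewrite mcoeffZ mcoeffX eq_mnm1 (negPf jni) mulr0.
rewrite big1 ?(dhomog_nemf_coeff hf) //.
  by apply/eqP => e; apply: hm; apply/mdeg1P; rewrite e.
move=> j _; rewrite mcoeffZ mcoeffX; case: eqP => [e|]; last by rewrite mulr0.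
by case: hm; exists j; rewrite e.
Qed.

Lemma homogmx1E p q (P : 'M[R]_(p, q)) : homogmx 1 P ->
  P = \sum_j 'X_j *: map_mx (@mpolyC c K) (cfmx U_(j) P).
Proof.
move=> hP; apply/matrixP => i l; rewrite summxE [LHS](homog1E (hP i l)).
by apply: eq_bigr => j _; rewrite !mxE mulrC mul_mpolyC.
Qed.

Lemma cfmx_mull1 p q r m (P : 'M_(p, q)) (Q : 'M_(q, r)) : homogmx 1 P ->
  cfmx m (P *m Q) = \sum_(j | (0 < m j)%N) cfmx U_(j) P *m cfmx (m - U_(j)) Q.
Proof.
move=> /homogmx1E {1}->; rewrite mulmx_suml /cfmx raddf_sum /= [RHS]big_mkcond.
apply: eq_bigr => j _; rewrite -scalemxAl -/(cfmx _ _) cfmx_X_scale lep1mP -lt0n.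
by case: ifP => // _; rewrite cfmx_Cmul.
Qed.

Lemma cfmx_mulr1 p q r m (P : 'M_(p, q)) (Q : 'M_(q, r)) : homogmx 1 Q ->
  cfmx m (P *m Q) = \sum_(j | (0 < m j)%N) cfmx (m - U_(j)) P *m cfmx U_(j) Q.
Proof.
move=> /homogmx1E {1}->; rewrite mulmx_sumr /cfmx raddf_sum /= [RHS]big_mkcond.
apply: eq_bigr => j _; rewrite -scalemxAr -/(cfmx _ _) cfmx_X_scale lep1mP -lt0n.
by case: ifP => // _; rewrite cfmx_mulC.
Qed.

Lemma cfmx_mul_eq0 p q r m (P : 'M_(p, q)) (Q : 'M_(q, r)) :
  (forall k, (k <= m)%MM -> cfmx k P = 0) -> cfmx m (P *m Q) = 0.
Proof.
move=> h; apply/matrixP => i j; rewrite !mxE raddf_sum big1 // => l _ /=.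
rewrite mcoeffM big1 // => -[a b] /= /eqP e.
have le_am : (a <= m)%MM by rewrite [X in (_ <= X)%MM]e lem_addr.
by have /matrixP/(_ i l) := h _ le_am; rewrite !mxE => ->; rewrite mul0r.
Qed.

(** A pure power factors only into pure powers of the same variable, and the degree of [Q] fixes the
    exponents, so the convolution has one term. *)
Lemma cfmx_axis p q r d (i0 : 'I_c) N (P : 'M_(p, q)) (Q : 'M_(q, r)) :
  homogmx d Q -> (d <= N)%N ->
  cfmx (U_(i0) *+ N)%MM (P *m Q) =
  cfmx (U_(i0) *+ (N - d))%MM P *m cfmx (U_(i0) *+ d)%MM Q.
Proof.
move=> hQ dN; apply/matrixP => i j; rewrite !mxE raddf_sum.
apply: eq_bigr => l _ /=; rewrite !mxE mcoeffM.
have ha : (mdeg (U_(i0) *+ (N - d))%MM < (mdeg (U_(i0) *+ N)%MM).+1)%N.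
  by rewrite !mdegMn mdeg1 !mul1n ltnS leq_subr.
have hb : (mdeg (U_(i0) *+ d)%MM < (mdeg (U_(i0) *+ N)%MM).+1)%N.
  by rewrite !mdegMn mdeg1 !mul1n ltnS.
rewrite (bigD1 (BMultinom ha, BMultinom hb)) /=; last first.
  apply/eqP/mnmP => z; rewrite mnmDE !mulmnE -mulnDr; congr (_ * _)%N; lia.
rewrite [X in _ + X]big1 ?addr0 // => -[[a a'] [b b']] /= /andP[/eqP e ne].
have [hb'|nb] := eqVneq (mdeg b) d; last first.
  by rewrite (dhomog_nemf_coeff (hQ l j) nb) mulr0.
case/negP: ne; rewrite xpair_eqE !bmeqP /=.
have e' z : z != i0 -> a z = 0%N /\ b z = 0%N.
  move=> /negPf zi; have /mnmP/(_ z) := e.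
  by rewrite mnmDE mulmnE mnm1E eq_sym zi mul0n; lia.
have eb : b i0 = d.
  by rewrite -hb' mdegE (bigD1 i0) //= big1 ?addn0 // => z /e'[].
have ea : a i0 = (N - d)%N.
  by have /mnmP/(_ i0) := e; rewrite mnmDE mulmnE mnm1E eqxx eb; lia.
apply/andP; split; apply/eqP/mnmP => z; rewrite mulmnE mnm1E.
  by have [<-|/eqP zi] := eqVneq i0 z; [rewrite mul1n | case: (e' z) => //; apply/eqP/nesym].
by have [<-|/eqP zi] := eqVneq i0 z; [rewrite mul1n | case: (e' z) => //; apply/eqP/nesym].
Qed.

End CoefficientMatrices.

(** * Lower bounds for linear complexes with null-homotopic powers of the variables *)

Section LinearStrand.
Local Open Scope ring_scope.
Variables (K : fieldType) (c' : nat).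
Local Notation c := c'.+1.
Local Notation R := {mpoly K[c]}.
(* M_{i+1} has rank [b i], with maps [D0] : M_1 -> M_0 = R and [D i] : M_{i+2} -> M_{i+1}. *)
Variables (b : nat -> nat) (D0 : 'cV[R]_(b 0%N)) (D : forall i, 'M[R]_(b i.+1, b i)).
Hypothesis c'_gt0 : (0 < c')%N.
Hypothesis D_lin : forall i, (i < c')%N -> homogmx 1 (D i).
Hypothesis DD0 : D 0%N *m D0 = 0.
Hypothesis DD : forall i, (i.+1 < c')%N -> D i.+1 *m D i = 0.

Implicit Types (js : nat -> 'I_c) (m : 'X_{1..c}).

(** The index sequence is a total function of which only the first [i] values are read, so positions
    can be swapped or overwritten freely. *)
Fixpoint strand (i : nat) js m : 'cV[K]_(b i) :=
  match i return 'cV[K]_(b i) with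
  | 0 => cfmx m D0
  | i.+1 => cfmx U_(js i) (D i) *m strand i js m
  end.

Definition setat p js q : nat -> 'I_c := fun r => if r == p then q else js r.
Definition swapn p r := if r == p then p.+1 else if r == p.+1 then p else r.

Lemma eq_strand i js js' m : (forall r, (r < i)%N -> js r = js' r) ->
  strand i js m = strand i js' m.
Proof.
elim: i => //= i IH h; rewrite h ?ltnS // IH // => r ri.
by apply: h; rewrite ltnS ltnW.
Qed.

(** This is the coefficient of y_j y_l in [D i.+1 *m D i = 0]. For j = l it is a single product, so
    squares vanish in characteristic 2 as well. *)
Lemma cfD_anticomm i j l : (i.+1 < c')%N ->
  cfmx U_(j) (D i.+1) *m cfmx U_(l) (D i) =
  - (if j == l then 0 else cfmx U_(l) (D i.+1) *m cfmx U_(j) (D i)).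
Proof.
move=> ic; have := cfmx_mull1 (U_(j) + U_(l))%MM (D i) (D_lin ic).
rewrite DD // cfmx0; have [<-|jl] := eqVneq j l.
  rewrite (bigD1 j) /=; last by rewrite mnmDE !mnm1E addn_gt0 !lt0b eqxx.
  rewrite addmK big1 ?addr0 => [<-|q /andP[+ /negPf qj]]; first by rewrite oppr0.
  by rewrite mnmDE !mnm1E eq_sym qj.
rewrite (bigD1 j) /=; last by rewrite mnmDE !mnm1E addn_gt0 !lt0b eqxx.
rewrite (bigD1 l) /=; last by rewrite mnmDE !mnm1E addn_gt0 !lt0b eqxx orbT eq_sym.
rewrite big1 ?addr0 => [|q /andP[/andP[+ /negPf qj] /negPf ql]]; last first.
  by rewrite mnmDE !mnm1E eq_sym qj eq_sym ql.
rewrite addmK [(U_(j) + _)%MM]addmC addmK => /eqP.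
by rewrite eq_sym addr_eq0 => /eqP.
Qed.

Lemma strand_swap i p js m : (i <= c')%N -> (p.+1 < i)%N ->
  strand i (js \o swapn p) m = - strand i js m.
Proof.
elim: i => // i IH ic pi.
have [lt_pi|] := ltnP p.+1 i.
  rewrite /= {1}/swapn; have -> : (i == p) = false by apply/eqP; lia.
  have -> : (i == p.+1) = false by apply/eqP; lia.
  by rewrite IH ?mulmxN // ltnW.
move=> le_ip; have e : i = p.+1 by lia.
move: ic pi; rewrite {le_ip}e => ic _ /=; rewrite /swapn !eqxx.
have -> : (p.+1 == p) = false by apply/eqP; lia.
rewrite (@eq_strand p (js \o swapn p) js) => [|r rp]; last first.
  by rewrite /= /swapn !ifF //; apply/eqP; lia.
rewrite !mulmxA cfD_anticomm //; case: eqP => [->|_]; last by rewrite mulNmx.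
by rewrite cfD_anticomm // eqxx !oppr0 !mul0mx oppr0.
Qed.

(** Neighbour swaps bring the equal indices together, where the square vanishes. The sign rule alone
    would not suffice in characteristic 2. *)
Lemma strand_rep i p q js m : (i <= c')%N -> (p < q < i)%N -> js p = js q ->
  strand i js m = 0.
Proof.
move=> ic; move e : (q - p)%N => k.
elim: k p js e => [|k IH] p js e /andP[pq qi] ejs; first by lia.
case: k IH e => [|k] IH e.
  have {e} e : q = p.+1 by lia.
  rewrite {q pq IH}e in qi ejs; elim: i ic qi => // i IH ic pi.
  have [lt_pi|le_ip] := ltnP p.+1 i; first by rewrite /= IH ?mulmx0 // ltnW.
  have e : i = p.+1 by lia.
  move: ic; rewrite e => ic /=; rewrite mulmxA -ejs cfD_anticomm // eqxx.
  by rewrite oppr0 mul0mx.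
apply/oppr_inj; rewrite oppr0 -(@strand_swap i p) //; last by lia.
apply: (IH p.+1); [lia| lia|]; rewrite /= /swapn eqxx.
by rewrite !ifF ?ejs //; apply/eqP; lia.
Qed.

(** At position 0 this is the coefficient of [m] in [D 0 *m D0 = 0]; neighbour swaps carry the free
    index up to position [p]. *)
Lemma strand_rel i p js m : (i <= c')%N -> (p < i)%N ->
  \sum_(q | (0 < m q)%N) strand i (setat p js q) (m - U_(q)) = 0.
Proof.
move=> ic; elim: p js => [|p IHp] js.
  elim: i ic => // i IH ic _; case: i IH ic => [|i] IH ic.
    by rewrite -[RHS](cfmx0 K (b 1) 1 m) -DD0 cfmx_mull1 //; apply: D_lin.
  rewrite (eq_bigr (fun q => cfmx U_(js i.+1) (D i.+1) *m
    strand i.+1 (setat 0 js q) (m - U_(q)))) //.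
  by rewrite -mulmx_sumr (IH (ltnW ic) isT) mulmx0.
move=> pi; apply/oppr_inj; rewrite oppr0 -[RHS](IHp (js \o swapn p) (ltnW pi)).
rewrite -sumrN; apply: eq_bigr => q _; rewrite -(@strand_swap i p) //.
apply: eq_strand => r _; rewrite /setat /swapn /=.
have pS : (p == p.+1) = false by apply/eqP; lia.
case: (r =P p) => [_|rp]; first by rewrite eqxx.
case: (r =P p.+1) => [_|rp1]; first by rewrite pS.
by rewrite (introF eqP rp1).
Qed.

Lemma perm_swapn i p js : (p.+1 < i)%N ->
  perm_eq (mkseq (js \o swapn p) i) (mkseq js i).
Proof.
move=> pi; rewrite /mkseq map_comp; apply: perm_map.
have pS : (p == p.+1) = false by apply/eqP; lia.
have swK : involutive (swapn p).
  move=> r; rewrite /swapn; case: (r =P p) => [->|rp]; first by rewrite eq_sym pS eqxx.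
  case: (r =P p.+1) => [->|rp1]; first by rewrite eqxx.
  by rewrite (introF eqP rp) (introF eqP rp1).
apply: uniq_perm; rewrite ?map_inj_uniq ?iota_uniq //; first exact: inv_inj.
move=> r; rewrite -{1}(swK r) mem_map ?mem_iota; last exact: inv_inj.
rewrite /swapn /=; case: (r =P p) => [->|rp]; first by rewrite pi (ltnW pi).
by case: (r =P p.+1) => [->|rp1] //; rewrite pi (ltnW pi).
Qed.

(** The sign is uniform in [m], which is what allows columns at different monomials to be compared
    later. *)
Lemma strand_perm i js js' : (i <= c')%N -> perm_eq (mkseq js i) (mkseq js' i) ->
  exists e : bool, forall m, strand i js m = (-1) ^+ e *: strand i js' m.
Proof.
elim: i js js' => [|i IH] js js' ic pe; first by exists false => m; rewrite scale1r.
have [e [js1 [e1 p1 v1]]] : exists (e : bool) js1, [/\ js1 i = js' i,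
    perm_eq (mkseq js1 i.+1) (mkseq js i.+1)
    & forall m, strand i.+1 js m = (-1) ^+ e *: strand i.+1 js1 m].
  have : js' i \in mkseq js i.+1.
    by rewrite (perm_mem pe) mkseqS mem_rcons mem_head.
  case/mapP => p; rewrite mem_iota => /andP[_ pi] ->.
  move ek : (i - p)%N => k; elim: k p js {pe} pi ek => [|k IHk] p js pi ek.
    exists false, js; split=> // [|m]; last by rewrite scale1r.
    by congr js; lia.
  have [|//|e [js1 [e1 p1 v1]]] := IHk p.+1 (js \o swapn p); [lia|lia|].
  exists (~~ e), js1; split=> [||m].
  - by rewrite e1 /= /swapn eqxx ifF //; apply/eqP; lia.
  - by apply: perm_trans p1 _; apply: perm_swapn; lia.
  rewrite -[LHS]opprK -(@strand_swap _ p) ?v1 //; last by lia.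
  by case: (e); rewrite ?expr1 ?scaleN1r ?scale1r ?opprK.
have [|e2 v2] := IH js1 js' (ltnW ic).
  have := perm_trans p1 pe; rewrite !mkseqS e1 -!cats1 perm_catC.
  by rewrite perm_sym perm_catC perm_cons perm_sym.
exists (e (+) e2) => m; rewrite v1 /= e1 v2 -scalemxAr scalerA.
by rewrite signr_addb.
Qed.

Lemma strand_rep_mem i js q p m : (i <= c')%N -> (p < i)%N ->
  (exists2 r, (r < i)%N && (r != p) & js r = q) -> strand i (setat p js q) m = 0.
Proof.
move=> ic pi [r /andP[ri rp] er].
have e : setat p js q p = setat p js q r by rewrite /setat eqxx (negPf rp).
have [lt_rp|] := ltnP r p; first by apply: (@strand_rep i r p) => //; rewrite lt_rp.
move=> le_pr; apply: (@strand_rep i p r) => //.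
by rewrite ri andbT ltn_neqAle eq_sym rp.
Qed.

Lemma miss_cases js q x : uniq (mkseq js c') -> q \notin mkseq js c' -> x != q ->
  exists2 r, (r < c')%N & js r = x.
Proof.
move=> us qs xq; have us' : uniq (q :: mkseq js c') by rewrite /= qs.
have : x \in q :: mkseq js c'.
  have ec : #|q :: mkseq js c'| = #|'I_c|.
    by rewrite (card_uniqP us') /= size_mkseq card_ord.
  have /(subset_cardP ec) -> // : q :: mkseq js c' \subset 'I_c by apply/subsetP.
by rewrite inE (negPf xq) => /mapP[r]; rewrite mem_iota => /andP[_ ri] ->; exists r.
Qed.

(** In [strand_rel] every value other than [js p] and the missing [q] repeats an index already used,
    so two terms remain. *)
Lemma strand_two_terms p js q m : (p < c')%N ->
  uniq (mkseq js c') -> q \notin mkseq js c' ->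
  (if (0 < m (js p))%N then strand c' js (m - U_(js p)) else 0) +
  (if (0 < m q)%N then strand c' (setat p js q) (m - U_(q)) else 0) = 0.
Proof.
move=> pc us qs.
have jspq : js p != q.
  by apply: contraNneq qs => <-; apply: map_f; rewrite mem_iota.
rewrite -[RHS](@strand_rel c' p js m) // big_mkcond /= (bigD1 (js p)) //=.
congr (_ + _).
  case: ifP => // _; apply: eq_strand => r _; rewrite /setat.
  by case: eqP => [->|].
rewrite (bigD1 q) /=; last by rewrite eq_sym.
rewrite big1 ?addr0 // => x /andP[xp xq]; case: ifP => // _.
apply: strand_rep_mem => //; have [r rc er] := miss_cases us qs xq.
by exists r => //; rewrite rc; apply: contraNneq xp => <-; rewrite er.
Qed.

(** The indices 1, ..., c', omitting 0. From r = c' on, [inord] falls back to 0, outside the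
    positions that are read. *)
Definition std_js (r : nat) : 'I_c := inord r.+1.
Definition top_strand al : 'cV[K]_(b c') := strand c' std_js (al + U_(ord0)).
Definition top_strand_at q m := if (0 < m q)%N then top_strand (m - U_(q))%MM else 0.

Lemma std_js_uniq : uniq (mkseq std_js c').
Proof.
rewrite map_inj_in_uniq ?iota_uniq // => x y; rewrite !mem_iota /= => hx hy.
by move/(congr1 val); rewrite /= !inordK //; case.
Qed.

Lemma std_js_miss : ord0 \notin mkseq std_js c'.
Proof.
apply/mapP => -[x]; rewrite mem_iota /= => hx /(congr1 val).
by rewrite /= inordK.
Qed.

Lemma perm_std js : uniq (mkseq js c') -> ord0 \notin mkseq js c' ->
  perm_eq (mkseq js c') (mkseq std_js c').
Proof.
move=> us qs; apply: uniq_perm => //; first exact: std_js_uniq.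
move=> x; have [->|x0] := eqVneq x ord0.
  by rewrite (negPf qs) (negPf std_js_miss).
have [r rc er] := miss_cases us qs x0.
have [r' rc' er'] := miss_cases std_js_uniq std_js_miss x0.
by rewrite -{1}er -er' !map_f ?mem_iota.
Qed.

Lemma uniq_setat p js q : (p < c')%N -> uniq (mkseq js c') -> q \notin mkseq js c' ->
  uniq (mkseq (setat p js q) c') /\ js p \notin mkseq (setat p js q) c'.
Proof.
move=> pc us qs.
have inj x y : (x < c')%N -> (y < c')%N -> js x = js y -> x = y.
  move=> xc yc e; apply/eqP; rewrite -(nth_uniq ord0 _ _ us) ?size_mkseq //.
  by rewrite !nth_mkseq // e.
have nq x : (x < c')%N -> js x <> q.
  by move=> xc e; case/negP: qs; rewrite -e map_f ?mem_iota.
split.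
  rewrite map_inj_in_uniq ?iota_uniq // => x y; rewrite !mem_iota /= => hx hy.
  rewrite /setat; case: eqP => [->|xp]; case: eqP => [->|yp] //.
  - by move/esym/nq; case.
  - by move/nq; case.
  - exact: inj.
apply/mapP => -[x]; rewrite mem_iota /= /setat => hx; case: eqP => [_|xp e].
  exact: nq.
by apply: xp; apply: inj.
Qed.

(** Permuting reduces q = 0 to the standard order. For other [q] the two-term relation at y_0 m
    exchanges the index 0 for [q], so up to sign the column depends only on m / y_q. *)
Lemma strand_missing js q : uniq (mkseq js c') -> q \notin mkseq js c' ->
  exists e : bool, forall m, strand c' js m = (-1) ^+ e *: top_strand_at q m.
Proof.
move=> us qs; have [eq0|q0] := eqVneq q ord0.
  rewrite eq0 in qs *; have [e he] := strand_perm (leqnn _) (perm_std us qs).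
  exists e => m; rewrite he /top_strand_at /top_strand; congr (_ *: _).
  case: ifPn => [m0|]; first by rewrite submK // lep1mP -lt0n.
  rewrite -eqn0Ngt => /eqP m0.
  (* When y_0 does not divide [m], the second term of this relation is absent, so the column is
     0. *)
  have := @strand_two_terms 0 std_js ord0 (m + U_(std_js 0))%MM c'_gt0
    std_js_uniq std_js_miss.
  have s0 : std_js 0 != ord0.
    by apply/eqP => /(congr1 val); rewrite /= inordK.
  rewrite !mnmDE !mnm1E eqxx (negPf s0) m0 addn1 /= addr0 addmK.
  by [].
have [|r rc er] := miss_cases us qs (x := ord0); first by rewrite eq_sym.
have [us' qs'] := uniq_setat rc us qs; rewrite er in qs'.
have [e he] := strand_perm (leqnn _) (perm_std us' qs'); exists (~~ e) => m.
have := strand_two_terms (m + U_(ord0))%MM rc us qs.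
rewrite er !mnmDE !mnm1E eqxx addn1 /= addmK [ord0 == q]eq_sym (negPf q0) addn0.
move/eqP; rewrite addr_eq0 => /eqP->; rewrite signrN scaleNr; congr (- _).
rewrite /top_strand_at; case: ifPn => mq; last by rewrite scaler0.
rewrite he /top_strand; congr (_ *: strand _ _ _); apply/mnmP => z.
by rewrite !(mnmDE, mnmBE, mnm1E); case: (q =P z) => [<-|_] /=; lia.
Qed.

(** * Homotopies for powers of the variables and the dual functionals *)

Variables (d N : nat) (dN : (d < N)%N) (d_gt0 : (0 < d)%N).
Hypothesis D0_homog : homogmx d D0.
Variables (s0 : 'I_c -> 'rV[R]_(b 0%N)) (s : 'I_c -> forall i, 'M[R]_(b i, b i.+1)).
Hypothesis hs0 : forall j, s0 j *m D0 = ('X_j ^+ N)%:M.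
Hypothesis hs1 : forall j, s j 0%N *m D 0 + D0 *m s0 j = ('X_j ^+ N)%:M.
Hypothesis hs2 : forall j i, (i.+1 < c')%N ->
  s j i.+1 *m D i.+1 + D i *m s j i = ('X_j ^+ N)%:M.

Local Notation js0 := std_js.
Implicit Types (al be : 'X_{1..c}).

(* Top component of the comparison map to M from the Koszul complex on y_0^N, ..., y_i^N. *)
Fixpoint koszul_row i : 'rV[R]_(b i) :=
  match i with 0 => s0 ord0 | i.+1 => koszul_row i *m s (inord i.+1) i end.

(** Write rho_i for [koszul_row i]. The homotopy identity gives rho_{i+1} D_i = y_{i+1}^N rho_i -
    (rho_i D_{i-1}) s, so inductively the entries lie in the ideal (y_0^N, ..., y_{i+1}^N). *)
Lemma koszul_row_low i m : (i < c')%N ->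
  (forall q : 'I_c, (q <= i.+1)%N -> (m q < N)%N) -> cfmx m (koszul_row i.+1 *m D i) = 0.
Proof.
have lowX p (j : 'I_c) (k : 'X_{1..c}) (P : 'M[R]_(1, p)) : (k j < N)%N ->
    cfmx k (('X_j ^+ N)%:M *m P) = 0.
  move=> kj; rewrite mul_scalar_mx mpolyXn cfmx_X_scale ifF //.
  apply: contraTF kj => /mnm_lepP/(_ j); rewrite mulmnE mnm1E eqxx mul1n.
  by rewrite -leqNgt.
have lowX' p (j : 'I_c) (k : 'X_{1..c}) (P : 'M[R]_(1, p)) : (k j < N)%N ->
    cfmx k (P *m ('X_j ^+ N)%:M) = 0.
  by move=> kj; rewrite scalar_mxC lowX.
elim: i m => [|i IH] m ic hm /=.
  rewrite -mulmxA -[s _ 0%N *m D 0%N](addrK (D0 *m s0 (inord 1))) hs1.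
  rewrite mulmxBr cfmxB lowX' ?hm ?inordK // sub0r mulmxA hs0.
  by rewrite lowX ?oppr0 // hm.
rewrite -mulmxA -[s _ i.+1 *m _](addrK (D i *m s (inord i.+2) i)) hs2 //.
rewrite mulmxBr cfmxB lowX' ?hm ?inordK // sub0r mulmxA.
rewrite cfmx_mul_eq0 ?oppr0 // => k /mnm_lepP km; apply: IH; first exact: ltnW.
by move=> q qi; apply: leq_ltn_trans (km q) _; apply/hm/ltnW.
Qed.

(** Its degree N - d + i (N - 1) is that of [koszul_row i] for homogeneous homotopies: N - d from
    [s0] and N - 1 from each [s]. *)
Definition corner_mon i : 'X_{1..c} :=
  [multinom if q == 0 :> nat then (N - d)%N else if (q <= i)%N then N.-1 else 0%N
   | q < c].

(** For q > 0 the index already occurs in the column; for q = 0 the relation at y_0^(d+1) has a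
    single term. *)
Lemma strand_axis_eq0 i q : (i < c')%N -> (q <= i)%N ->
  cfmx U_(inord q) (D i) *m strand i js0 (U_(ord0) *+ d)%MM = 0.
Proof.
move=> ic qi; have -> : cfmx U_(inord q) (D i) *m strand i js0 (U_(ord0) *+ d) =
    strand i.+1 (setat i js0 (inord q)) (U_(ord0) *+ d).
  rewrite /= {1}/setat eqxx; congr (_ *m _); apply: eq_strand => r ri.
  by rewrite /setat ltn_eqF.
case: q qi => [_|q qi]; last first.
  apply: strand_rep_mem => //.
  by exists q => //; rewrite ltn_eqF // ltnW.
have -> : inord 0 = ord0 :> 'I_c by apply/val_inj; rewrite /= inordK.
have := strand_rel js0 (U_(ord0) *+ d.+1)%MM ic (ltnSn i).
rewrite (bigD1 ord0) /=; last by rewrite mulmnE mnm1E eqxx.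
rewrite big1 ?addr0 => [|x /andP[+ /negPf x0]]; last first.
  by rewrite mulmnE mnm1E eq_sym x0.
by rewrite mulmSr addmK.
Qed.

(** Read rho_{i+1} D_i at the corner monomial times y_{i+1} in two ways. Expanding the linear [D i],
    all terms but one die by [strand_axis_eq0] or divisibility. By the homotopy identity it is
    y_{i+1}^N rho_i up to entries in (y_0^N, ..., y_i^N), which have no such coefficient. *)
Lemma koszul_row_corner i : (i <= c')%N ->
  (cfmx (corner_mon i) (koszul_row i) *m strand i js0 (U_(ord0) *+ d)%MM) 0 0 = 1.
Proof.
elim: i => [|i IH] ic.
  have -> : corner_mon 0 = (U_(ord0) *+ (N - d))%MM.
    apply/mnmP => q; rewrite mnmE mulmnE mnm1E -val_eqE /=.
    by case: q => -[|q] hq; rewrite /= ?mul1n ?mul0n.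
  rewrite /= -(@cfmx_axis K c _ _ _ d) // ?(ltnW dN) // hs0 !mxE eqxx mulr1n.
  by rewrite mcoeffXn eqxx.
have ip : (inord i.+1 : 'I_c) = i.+1 :> nat by rewrite inordK.
set p := inord i.+1 : 'I_c in ip.
set w := strand i js0 (U_(ord0) *+ d)%MM.
have em : corner_mon i.+1 = (corner_mon i + U_(p) *+ N.-1)%MM.
  apply/mnmP => q; rewrite mnmDE !mnmE mulmnE mnm1E -val_eqE /= ip.
  case: q => -[|q] hq /=; first by rewrite mul0n addn0.
  by rewrite eqSS ltnS; case: (ltngtP i q) => _; rewrite ?mul1n ?mul0n ?addn0.
have mup : corner_mon i.+1 p = N.-1 by rewrite mnmE ip /= leqnn.
have -> : strand i.+1 js0 (U_(ord0) *+ d)%MM = cfmx U_(p) (D i) *m w by [].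
rewrite mulmxA.
transitivity ((cfmx (corner_mon i.+1 + U_(p))%MM (koszul_row i.+1 *m D i) *m w) 0 0).
  rewrite [cfmx _ (_ *m D i)]cfmx_mulr1; last exact: D_lin.
  rewrite (bigD1 p) /=; last by rewrite mnmDE mnm1E eqxx addn1.
  rewrite addmK mulmxDl mulmx_suml big1 ?addr0 // => q /andP[mq qp].
  rewrite -mulmxA; have [qi|iq] := leqP q i.
    by rewrite -[q]inord_val strand_axis_eq0 ?mulmx0.
  move: mq; rewrite mnmDE mnm1E eq_sym (negPf qp) addn0 mnmE.
  have qi2 : (i.+1 < q)%N.
    by rewrite ltn_neqAle iq andbT; apply: contra qp => /eqP e; apply/eqP/val_inj; rewrite /= ip.
  have q0 : (q == 0 :> nat) = false by apply/eqP; lia.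
  by rewrite q0 [(q <= _)%N]leqNgt qi2.
transitivity ((cfmx (corner_mon i.+1 + U_(p))%MM (('X_p ^+ N)%:M *m koszul_row i) *m w) 0 0);
  last first.
  rewrite mul_scalar_mx mpolyXn cfmx_X_scale em -addmA -mulmSr prednK; last lia.
  by rewrite lem_addl addmK IH // ltnW.
have Dlt (q : 'I_c) : (q <= i)%N -> ((corner_mon i.+1 + U_(p))%MM q < N)%N.
  move=> qi; rewrite mnmDE mnm1E -val_eqE /= ip eqn_leq [(i < q)%N]ltnNge qi /=.
  by rewrite addn0 mnmE; case: ifP => _; [lia|rewrite (leqW qi); lia].
congr ((_ *m _) 0 0); rewrite /= -mulmxA.
case: i IH ic @p ip @w em mup Dlt => [|i] IH ic p ip w em mup Dlt.
  rewrite -[s _ 0%N *m D 0%N](addrK (D0 *m s0 p)) hs1 mulmxBr cfmxB scalar_mxC.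
  rewrite mulmxA hs0 [X in _ - X](_ : _ = 0) ?subr0 //.
  rewrite mul_scalar_mx mpolyXn cfmx_X_scale ifF //.
  apply/negP => /mnm_lepP/(_ ord0); rewrite mulmnE mnm1E eqxx mul1n leqNgt.
  by rewrite Dlt.
rewrite -[s _ i.+1 *m _](addrK (D i *m s p i)) hs2 // mulmxBr cfmxB scalar_mxC.
rewrite [X in _ - cfmx _ X]mulmxA [X in _ - X]cfmx_mul_eq0 ?subr0 // => k /mnm_lepP km.
apply: (@koszul_row_low i); first exact: ltnW.
by move=> q qi; apply: leq_ltn_trans (km q) _; apply: Dlt.
Qed.

Definition residue m al : K := (cfmx m (koszul_row c') *m top_strand al) 0 0.

(* Modulo the image of [D], E = top_strand satisfies y_j E(al) = y_l E(al + e_l - e_j), which is 0 if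
   al_j = 0. *)
Lemma residue_rule m al j l : j != l -> (forall q, (m q < N)%N) ->
  (if (0 < m j)%N then residue (m - U_(j)) al else 0) =
  (if (0 < m l)%N && (0 < al j)%N then residue (m - U_(l)) (al + U_(l) - U_(j)) else 0).
Proof.
move=> jl mN.
(* All indices except [j] and [l], followed by [j]: the last slot holds [j], and the missing index
   is [l]. *)
pose js r := nth ord0 (rcons (rem l (rem j (enum 'I_c))) j) r.
have ec : c' = c'.-1.+1 by rewrite prednK.
have jmem : j \in enum 'I_c by rewrite mem_enum.
have uj : uniq (rem j (enum 'I_c)) by rewrite rem_uniq // enum_uniq.
have lmem : l \in rem j (enum 'I_c).
  by rewrite mem_rem_uniq ?enum_uniq // inE eq_sym jl mem_enum.
have sz : size (rem l (rem j (enum 'I_c))) = c'.-1.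
  by rewrite !size_rem // size_enum_ord.
have ejs : mkseq js c' = rcons (rem l (rem j (enum 'I_c))) j.
  apply: (@eq_from_nth _ ord0); first by rewrite size_mkseq size_rcons sz.
  by move=> i; rewrite size_mkseq => hi; rewrite nth_mkseq.
have jslast : js c'.-1 = j by rewrite /js -sz nth_rcons ltnn eqxx.
have us : uniq (mkseq js c').
  rewrite ejs rcons_uniq rem_uniq // andbT mem_rem_uniq //= !inE.
  by rewrite mem_rem_uniq ?enum_uniq // !inE eqxx andbF.
have lnot : l \notin mkseq js c'.
  rewrite ejs mem_rcons inE eq_sym (negPf jl) /= mem_rem_uniq //.
  by rewrite !inE eqxx.
have [e he] := strand_missing us lnot.
pose p := c'.-1; have ep : p.+1 = c' by rewrite /p prednK.
(* Stated for any [i] equal to [c'], these facts also apply at [p.+1], where the types mention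
   [b p.+1] in place of [b c']. *)
have he' i : i = c' -> forall m', strand i js m' = (-1) ^+ e *:
    (if (0 < m' l)%N then strand i js0 (m' - U_(l) + U_(ord0))%MM else 0).
  by move=> ->.
have htwo i : i = c' -> forall m',
    (if (0 < m' j)%N then strand i js (m' - U_(j)) else 0) +
    (if (0 < m' l)%N then strand i (setat p js l) (m' - U_(l)) else 0) = 0.
  by move=> -> m'; rewrite -jslast; apply: strand_two_terms; rewrite // ep.
have hres i : i = c' -> forall m' al', residue m' al' =
    (cfmx m' (koszul_row i) *m strand i js0 (al' + U_(ord0))%MM) 0 0.
  by move=> ->.
pose u := strand p js (al + U_(l))%MM.
have Au q : cfmx U_(q) (D p) *m u = strand p.+1 (setat p js q) (al + U_(l))%MM.
  rewrite /= {1}/setat eqxx; congr (_ *m _); apply: eq_strand => r ri.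
  by rewrite /setat ltn_eqF.
(* Expanding the linear [D p] puts each [q] into the last slot of the column; only [j] and [l] avoid
   a repetition. *)
have : (cfmx m (koszul_row p.+1 *m D p) *m u) 0 0 = 0.
  by rewrite koszul_row_low ?mul0mx ?mxE // ep.
rewrite [cfmx _ (_ *m D _)]cfmx_mulr1; last by apply: D_lin; rewrite ep.
rewrite mulmx_suml summxE big_mkcond (bigD1 j) //= (bigD1 l) /=; last by rewrite eq_sym.
rewrite [X in _ + (_ + X)]big1 => [|q /andP[qj ql]]; last first.
  case: ifP => // _; rewrite -mulmxA Au.
  rewrite strand_rep_mem ?mulmx0 ?mxE // ?ep //.
  have [r rc er] := miss_cases us lnot ql; exists r => //; rewrite rc /=.
  by apply: contraNneq qj => er'; rewrite -er er' jslast.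
rewrite [X in _ + X]addr0.
have -> : (if (0 < m j)%N then (cfmx (m - U_(j)) (koszul_row p.+1) *m
     cfmx U_(j) (D p) *m u) 0 0 else 0) =
   (-1) ^+ e * (if (0 < m j)%N then residue (m - U_(j)) al else 0).
  case: ifP => _; last by rewrite mulr0.
  rewrite -mulmxA Au.
  have -> : strand p.+1 (setat p js j) (al + U_(l))%MM =
            strand p.+1 js (al + U_(l))%MM.
    apply: eq_strand => r _; rewrite /setat; case: eqP => // ->.
    by rewrite jslast.
  rewrite (hres _ ep) (he' _ ep) mnmDE mnm1E eqxx addn1 /= addmK.
  by rewrite -scalemxAr mxE.
have -> : (if (0 < m l)%N then (cfmx (m - U_(l)) (koszul_row p.+1) *m
     cfmx U_(l) (D p) *m u) 0 0 else 0) =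
   - (-1) ^+ e * (if (0 < m l)%N && (0 < al j)%N then
       residue (m - U_(l)) (al + U_(l) - U_(j)) else 0).
  case: ifP => _ /=; last by rewrite mulr0.
  rewrite -mulmxA Au; have := htwo _ ep (al + U_(l) + U_(l))%MM.
  rewrite addmK !mnmDE !mnm1E eqxx !addn1 ltn0Sn.
  rewrite eq_sym (negPf jl) !addn0 => /eqP; rewrite addrC addr_eq0 => /eqP->.
  case: ifP => aj; last by rewrite oppr0 mulmx0 mxE mulr0.
  have -> : (al + U_(l) + U_(l) - U_(j))%MM = (al + U_(l) - U_(j) + U_(l))%MM.
    by apply/mnmP => z; rewrite !(mnmDE, mnmBE, mnm1E); case: (j =P z) => [<-|_]; lia.
  rewrite (he' _ ep) mnmDE mnm1E eqxx addn1 /= addmK mulmxN -scalemxAr (hres _ ep).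
  by rewrite !mxE mulNr.
move/eqP; rewrite mulNr subr_eq0 => /eqP.
by apply: mulfI; rewrite signr_eq0.
Qed.

(** The complement of [be] in the socle monomial of K[y]/(y_0^N, ..., y_{c'}^N). *)
Definition dual_mon be : 'X_{1..c} := [multinom (N.-1 - be q)%N | q < c].

(** [residue_rule] at the dual monomial times y_j, whose exponents stay below [N] because be_j > 0.
    As [be] has degree below d < N, no subtraction in [dual_mon] truncates. *)
Lemma residue_move al be j l : j != l -> (mdeg be < d)%N -> (0 < be j)%N ->
  residue (dual_mon be) al = if (0 < al j)%N
    then residue (dual_mon (be + U_(l) - U_(j))) (al + U_(l) - U_(j)) else 0.
Proof.
move=> jl bed bej.
have beN q : (be q <= mdeg be)%N by rewrite mdegE (bigD1 q) //= leq_addr.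
have := @residue_rule (dual_mon be + U_(j))%MM al j l jl.
rewrite addmK mnmDE mnm1E eqxx addn1 /= => ->; last first.
  move=> q; rewrite mnmDE mnm1E mnmE; case: (j =P q) => [<-|_]; lia.
have -> : (0 < (dual_mon be + U_(j))%MM l)%N.
  by rewrite mnmDE mnmE; have := beN l; lia.
rewrite andTb.
suff -> : (dual_mon be + U_(j) - U_(l))%MM = dual_mon (be + U_(l) - U_(j)) by [].
apply/mnmP => z; rewrite !(mnmDE, mnmBE, mnm1E, mnmE).
have := beN z; case: (j =P z) => [<-|_]; case: (l =P z) => [|_] //=; lia.
Qed.

(** Moving exponent from [j] to [l] changes [al] and [be] alike. If they differ, some al_j < be_j
    runs out first and gives 0; if they agree, everything moves into y_0, where [koszul_row_corner]
    gives 1. *)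
Lemma residue_delta al be : mdeg al = d.-1 -> mdeg be = d.-1 ->
  residue (dual_mon be) al = (al == be)%:R.
Proof.
have mdeg_move m j l : (0 < m j)%N -> mdeg (m + U_(l) - U_(j))%MM = mdeg m.
  move=> mj; have le : (U_(j) <= m + U_(l))%MM by rewrite lep1mP mnmDE; lia.
  by apply/eqP; rewrite -(eqn_add2r 1) -{1}(mdeg1 j) -mdegD submK // mdegD mdeg1.
have [->|] := eqVneq al be; last first.
  move=> ne hal hbe.
  have [j hj] : exists j, (al j < be j)%N.
    apply/existsP; apply: contraTT isT => /existsPn h; case/negP: ne.
    have hle q : (be q <= al q)%N by rewrite leqNgt h.
    apply/eqP/mnmP => q; apply/eqP; rewrite eqn_leq hle andbT leqNgt.
    apply/negP => lt.
    have : (mdeg be < mdeg al)%N.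
      rewrite !mdegE (bigD1 q) //= [X in (_ < X)%N](bigD1 q) //=.
      by rewrite -addSn leq_add // leq_sum.
    by rewrite hal hbe ltnn.
  have [l hl] : exists l, (be l < al l)%N.
    apply/existsP; apply: contraTT isT => /existsPn h.
    have hle q : (al q <= be q)%N by rewrite leqNgt h.
    have : (mdeg al < mdeg be)%N.
      rewrite !mdegE (bigD1 j) //= [X in (_ < X)%N](bigD1 j) //=.
      by rewrite -addSn leq_add // leq_sum.
    by rewrite hal hbe ltnn.
  have jl : j != l by apply: contraTneq hj => ->; rewrite -leqNgt ltnW.
  move ek : (al j) => k; elim: k al be hal hbe hj ek {ne hl} => [|k IH] al be hal hbe hj ek.
    rewrite (residue_move _ jl) ?ek //; [by rewrite hbe prednK|by lia].
  rewrite (residue_move _ jl) ?ek /=; [|by rewrite hbe prednK|by lia].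
  apply: IH; rewrite ?mdeg_move ?ek //; try lia.
    by rewrite !(mnmBE, mnmDE, mnm1E) eqxx eq_sym (negPf jl); lia.
  by rewrite !(mnmBE, mnmDE, mnm1E) eqxx eq_sym (negPf jl) ek; lia.
move=> hbe _; move ek : (mdeg be - be ord0)%N => k.
elim: k be hbe ek {al} => [|k IH] be hbe ek.
  have be0 z : z != ord0 -> be z = 0%N.
    move=> z0; have := mdegE be; rewrite (bigD1 ord0) //= (bigD1 z) //=; lia.
  have eb0 : be ord0 = d.-1.
    have := mdegE be; rewrite (bigD1 ord0) //= big1 ?addn0 ?hbe // => z; exact: be0.
  rewrite /residue /top_strand; have -> : (be + U_(ord0))%MM = (U_(ord0) *+ d)%MM.
    apply/mnmP => z; rewrite mnmDE mulmnE mnm1E; case: (ord0 =P z) => [<-|/eqP ne].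
      by rewrite eb0; lia.
    by rewrite be0 // eq_sym.
  have -> : dual_mon be = corner_mon c'; last exact: koszul_row_corner.
  apply/mnmP => z; rewrite !mnmE; case: eqP => [e|/eqP e].
    have -> : z = ord0 by apply/val_inj.
    by rewrite eb0; lia.
  by rewrite be0 ?subn0 // ifT // -ltnS ltn_ord.
have [j j0 bej] : exists2 j, j != ord0 & (0 < be j)%N.
  have /eqP : mdeg be != be ord0 by lia.
  rewrite mdegE (bigD1 ord0) //= => /eqP; rewrite -{2}[be ord0]addn0 eqn_add2l.
  by rewrite sum_nat_eq0 negb_forall => /existsP[j]; rewrite negb_imply -lt0n => /andP[]; exists j.
rewrite (residue_move _ j0) ?bej // ?hbe ?prednK //.
rewrite IH ?mdeg_move ?eqxx //.
by rewrite !(mnmBE, mnmDE, mnm1E) (negPf j0) eqxx; lia.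
Qed.

Fixpoint strand_tail i k js : 'M[K]_(b (k + i), b i) :=
  match k return 'M[K]_(b (k + i), b i) with
  | 0 => 1%:M
  | k.+1 => cfmx U_(js (k + i)%N) (D (k + i)%N) *m strand_tail i k js
  end.

Lemma strand_tailE i k js m : strand_tail i k js *m strand i js m = strand (k + i)%N js m.
Proof. by elim: k => [|k IH] /=; rewrite ?mul1mx // -mulmxA IH. Qed.

Lemma eq_strand_tail i k js js' : (forall r, (i <= r)%N -> js r = js' r) ->
  strand_tail i k js = strand_tail i k js'.
Proof. by move=> e; elim: k => //= k ->; rewrite e // leq_addl. Qed.

Lemma strand_nth_missing (t : seq 'I_c) q m : size t = c' -> uniq t -> q \notin t ->
  exists e : bool, strand c' (nth ord0 t) m = (-1) ^+ e *: top_strand_at q m.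
Proof.
move=> szt ut qt; have em : mkseq (nth ord0 t) c' = t by rewrite -[RHS](mkseq_nth ord0) szt.
by have [||e he] := @strand_missing (nth ord0 t) q; rewrite ?em //; exists e.
Qed.

(* [x] gives the column of the indices [J x] at the monomial [w x + e_(p x)], and the functional
   that multiplies by the maps indexed outside [J x] and [p x] and then extracts [w x]. *)
Lemma card_le_strand (X : finType) (i : nat) (p : X -> 'I_c) (J : X -> seq 'I_c)
    (w : X -> 'X_{1..c}) : (i <= c')%N ->
  (forall x, uniq (J x)) -> (forall x, size (J x) = i) ->
  (forall x q, q \in J x -> (q < p x)%N) ->
  (forall x, mdeg (w x) = d.-1) ->
  (forall x q, (0 < w x q)%N -> (q <= p x)%N) ->
  (forall x y, p x = p y -> J x =i J y -> w x = w y -> x = y) ->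
  (#|X| <= b i)%N.
Proof.
move=> ic uJ szJ Jp dw wp inj.
pose T x := [seq q <- enum 'I_c | (q \notin J x) && (q != p x)].
pose k := (c' - i)%N; have ek : (k + i)%N = c' by rewrite subnK.
have TE x q : q \in T x = (q \notin J x) && (q != p x).
  by rewrite mem_filter mem_enum andbT.
have pJ x : p x \notin J x by apply/negP => /Jp; rewrite ltnn.
have uT x : uniq (T x) by rewrite filter_uniq // enum_uniq.
have szT x : size (T x) = k.
  have us : uniq (p x :: J x ++ T x).
    rewrite /= mem_cat negb_or pJ TE eqxx andbF /= cat_uniq uJ uT andbT /=.
    by apply/hasPn => q; rewrite TE => /andP[].
  have : size (p x :: J x ++ T x) = c.
    rewrite -(card_uniqP us) -[RHS]card_ord; apply: eq_card => q.
    rewrite inE mem_cat TE; case: (q == p x) => //=.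
    by case: (q \in J x).
  rewrite /= size_cat szJ => -[e]; apply/eqP.
  by rewrite -(eqn_add2r i) ek addnC e.
pose sq x y := J y ++ T x.
have szs x y : size (sq x y) = c' by rewrite size_cat szJ szT addnC.
pose m y := (w y + U_(p y))%MM.
pose Xr x : 'rV_(b i) :=
  cfmx (dual_mon (w x)) (koszul_row (k + i)) *m strand_tail i k (nth ord0 (sq x x)).
pose Yc y : 'cV_(b i) := strand i (nth ord0 (J y)) (m y).
have Rn n : n = c' -> forall be js m',
    (cfmx be (koszul_row n) *m strand n js m') 0 0 =
    (cfmx be (koszul_row c') *m strand c' js m') 0 0.
  by move=> ->.
have XY x y : (Xr x *m Yc y) 0 0 =
    (cfmx (dual_mon (w x)) (koszul_row c') *m strand c' (nth ord0 (sq x y)) (m y)) 0 0.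
  rewrite -(Rn _ ek) -strand_tailE mulmxA; congr ((_ *m _ *m _) 0 0).
    by apply: eq_strand_tail => r ir; rewrite !nth_cat !szJ ltnNge ir.
  by apply: eq_strand => r ri; rewrite nth_cat szJ ri.
have val x y q : uniq (sq x y) -> q \notin sq x y -> exists e : bool,
    (Xr x *m Yc y) 0 0 = (-1) ^+ e * ((0 < m y q)%N && (m y == w x + U_(q))%MM)%:R.
  move=> us qs; have [e he] := strand_nth_missing (m y) (szs x y) us qs.
  exists e; rewrite XY he -scalemxAr mxE /top_strand_at; congr (_ * _).
  case: ifPn => [mq|_]; last by rewrite mulmx0 mxE.
  have le : (U_(q) <= m y)%MM by rewrite lep1mP -lt0n.
  have hd : mdeg (m y - U_(q))%MM = d.-1.
    apply/eqP; rewrite -(eqn_add2r 1) -{1}(mdeg1 q) -mdegD submK //.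
    by rewrite mdegD mdeg1 dw.
  by rewrite -/(residue _ _) residue_delta // -(eqm_add2r U_(q)) submK.
have diag x : exists e : bool, (Xr x *m Yc x) 0 0 = (-1) ^+ e.
  have us : uniq (sq x x).
    rewrite cat_uniq uJ uT andbT /=.
    by apply/hasPn => q; rewrite TE => /andP[].
  have [|e ->] := val x x (p x) us.
    by rewrite mem_cat negb_or pJ TE eqxx andbF.
  exists e; rewrite eqxx /m mnmDE mnm1E eqxx addn_gt0 lt0b orbT.
  by rewrite mulr1.
have offdiag x y : x != y -> (Xr x *m Yc y) 0 0 = 0.
  move=> ne; have [us|] := boolP (uniq (sq x y)); last first.
    case/(uniqPn ord0) => a [a' [lt la e]]; rewrite XY (@strand_rep c' a a') ?mulmx0 ?mxE //.
    by rewrite lt -(szs x y).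
  have [q qs] : exists q, q \notin sq x y.
    apply/existsP; apply: contraTT isT => /existsPn h.
    have := card_uniqP us; rewrite szs.
    have -> : #|sq x y| = c.
      by rewrite -[RHS]card_ord; apply: eq_card => q; have := h q; rewrite negbK.
    by move/eqP; rewrite eqn_leq ltnn.
  have [e ->] := val x y q us qs.
  case: (boolP ((0 < m y q)%N && _)) => [/andP[mq /eqP em]|]; last by rewrite mulr0.
  case/negP: ne; apply/eqP.
  have smem z : z != q -> z \in sq x y.
    move=> zq; apply: contraT => zs.
    have us' : uniq [:: z, q & sq x y] by rewrite /= inE negb_or zq zs qs us.
    have := max_card (mem [:: z, q & sq x y]); rewrite (card_uniqP us') /= szs card_ord.
    by rewrite ltnn.
  have qT : q \notin T x by apply: contra qs; rewrite mem_cat orbC => ->.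
  have pyx : (0 < w x (p y) + (q == p y))%N.
    have := mnm1E q (p y) => <-; rewrite -mnmDE -em /m mnmDE mnm1E eqxx.
    by rewrite addn_gt0 lt0b orbT.
  (* Otherwise p x lies in J y and q in J x, so q < p x < p y; but y_{p y} divides w x, whence p y
     <= p x, or p y = q. Both are impossible. *)
  have pxq : p x = q.
    apply/eqP; apply: contraT => pxq; have := smem _ pxq.
    rewrite mem_cat TE eqxx andbF orbF => /Jp pxy.
    move: qT; rewrite TE negb_and !negbK [q == _]eq_sym (negPf pxq) orbF => /Jp qpx.
    move: pyx; rewrite addn_gt0 lt0b => /orP[/wp|/eqP qy].
      by rewrite leqNgt pxy.
    by rewrite -qy in pxy; rewrite ltnNge (ltnW pxy) in qpx.
  have le_yx : (p y <= p x)%N.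
    by move: pyx; rewrite addn_gt0 lt0b => /orP[/wp //|/eqP <-]; rewrite pxq.
  have le_xy : (p x <= p y)%N.
    move: mq; rewrite -pxq /m mnmDE mnm1E addn_gt0 lt0b => /orP[/wp //|/eqP -> //].
  have epxy : p x = p y by apply/val_inj/eqP; rewrite /= eqn_leq le_xy le_yx.
  apply: inj => //; last first.
    by apply: (@addIm _ U_(q)%MM); rewrite -em /m -epxy pxq.
  have sJ : {subset J y <= J x}.
    move=> z zJ; apply: contraT => znJ.
    have zp : z != p x by rewrite epxy; apply: contraNneq (pJ y) => <-.
    have : z \in T x by rewrite TE znJ.
    by move: us; rewrite cat_uniq => /and3P[_ /hasPn h _] /h; rewrite zJ.
  have [|_ h] := uniq_min_size (uJ y) sJ; first by rewrite !szJ.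
  by move=> z; rewrite h.
pose XM := \matrix_(a < #|X|) Xr (enum_val a).
pose YM := (\matrix_(a < #|X|) (Yc (enum_val a))^T)^T.
have eM a a' : (XM *m YM) a a' = (Xr (enum_val a) *m Yc (enum_val a')) 0 0.
  by rewrite !mxE; apply: eq_bigr => z _; rewrite !mxE.
(* A diagonal matrix of signs is its own inverse, so [XM] has a right inverse and its number of rows
   is at most [b i]. *)
apply: (@mulmx1_min _ _ _ XM (YM *m (XM *m YM))); rewrite mulmxA.
have {2}-> : XM *m YM = diag_mx (\row_a (XM *m YM) a a).
  apply/matrixP => a a'; rewrite [RHS]mxE [X in _ = X *+ _]mxE.
  have [<-|ne] := eqVneq a a'; first by rewrite mulr1n.
  by rewrite mulr0n eM offdiag // (inj_eq enum_val_inj).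
apply/matrixP => a a'; rewrite mul_mx_diag mxE [RHS]mxE ![(\row_ _ _) _ _]mxE !eM.
have [<-|ne] := eqVneq a a'.
  by have [e ->] := diag (enum_val a); rewrite -expr2 sqrr_sign.
by rewrite offdiag ?mul0r // (inj_eq enum_val_inj).
Qed.

(** The index set is that of the Eliahou-Kervaire symbols: a monomial w y_p of degree [d] with
    largest variable y_p, and an [i]-subset of the indices below [p]. The factor w is encoded by a
    tuple of exponents with sum d - 1. *)
Lemma sum_bin_le_strand_rank i : (i <= c')%N ->
  (\sum_(p < c) 'C(p, i) * 'C(p + d.-1, p) <= b i)%N.
Proof.
move=> ic.
pose X : finType := {p : 'I_c & ({J : {set 'I_p} | #|J| == i} *
   {w : p.+1.-tuple 'I_d.-1.+1 | (\sum_(z <- w) z == d.-1)%N})%type}.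
pose P (x : X) : 'I_c := tag x.
pose wd (p : 'I_c) (z : 'I_p) : 'I_c := widen_ord (ltnW (ltn_ord p)) z.
have wd_inj p : injective (@wd p) by move=> z z' /(congr1 val) e; apply/val_inj.
pose J (x : X) := [seq wd (P x) z | z <- enum (val (tagged x).1)].
pose W (x : X) : 'X_{1..c} :=
  [multinom if (q <= P x)%N then val (tnth (val (tagged x).2) (inord q)) else 0%N | q < c].
have -> : (\sum_(p < c) 'C(p, i) * 'C(p + d.-1, p))%N = #|X|.
  rewrite card_tagged sumnE big_map big_enum /=; apply: eq_bigr => p _.
  rewrite card_prod !card_sig; congr (_ * _)%N.
    have := card_draws 'I_p i; rewrite card_ord => <-.
    by apply: eq_card => A; rewrite !inE.
  by rewrite -card_ord_partitions; apply: eq_card => A; rewrite !inE.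
apply: (@card_le_strand X i P J W) => //.
- by move=> x; rewrite map_inj_uniq ?enum_uniq //; apply: wd_inj.
- by move=> x; rewrite size_map -cardE; apply/eqP/(valP (tagged x).1).
- by move=> x q /mapP[z _ ->]; rewrite /= ltn_ord.
- move=> x; rewrite mdegE -[RHS](eqP (valP (tagged x).2)).
  rewrite (bigID (fun q : 'I_c => (q <= P x)%N)) /= [X in (_ + X)%N]big1 ?addn0; last first.
    by move=> q /negPf h; rewrite mnmE h.
  rewrite big_tuple (reindex_onto (fun z : 'I_(P x).+1 => widen_ord (ltn_ord (P x)) z : 'I_c)
    (fun q : 'I_c => inord q)) /=; last first.
    by move=> q qP; apply/val_inj; rewrite /= inordK.
  apply: eq_big => [z|z _]; last by rewrite mnmE /= -ltnS ltn_ord inord_val.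
  by rewrite inord_val eqxx andbT -ltnS ltn_ord.
- by move=> x q; rewrite mnmE; case: ifP.
move=> [p [[A hA] [w hw]]] [p' [[A' hA'] [w' hw']]]; rewrite /P /= => epp.
subst p'; rewrite /J /W /P /= => eJ eW.
have eA : A = A'.
  apply/setP => z; have := eJ (wd p z).
  by rewrite !(mem_map (@wd_inj p)) !mem_enum.
have ew : w = w'.
  apply: eq_from_tnth => z; move/mnmP/(_ (widen_ord (ltn_ord p) z)): eW.
  by rewrite !mnmE /= -ltnS ltn_ord inord_val => /val_inj ->.
by subst A' w'; rewrite (eq_irrelevance hA hA') (eq_irrelevance hw hw').
Qed.

End LinearStrand.

(** * The linear part of a resolution *)

Section GradedParts.
Local Open Scope ring_scope.
Variables (k : fieldType) (n : nat).
Local Notation S := {mpoly k[n]}.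

(** Degrees are integers because the shifts [fdeg] are; a negative degree has zero part. *)
Definition hpart (z : int) (f : S) : S :=
  if z is Posz e then pihomog mdeg e f else 0.

Lemma mcoeff_pihomog e (f : S) m :
  (pihomog mdeg e f)@_m = if mdeg m == e then f@_m else 0.
Proof.
elim/mpolyind: f => [|a m' f _ _ IH]; first by rewrite pihomog0 mcoeff0 if_same.
rewrite linearP /= !mcoeffD !mcoeffZ IH pihomogX mcoeffX.
case: (m' =P m) => [->|/eqP ne].
  by case: ifP => _; rewrite ?mcoeffX ?eqxx // mcoeff0 mulr0 add0r.
rewrite [X in a * X](_ : _ = 0) ?mulr0 ?add0r //.
by case: ifP; rewrite ?mcoeff0 // mcoeffX (negPf ne).
Qed.

Lemma mcoeff_hpart z (f : S) m :
  (hpart z f)@_m = if (mdeg m)%:Z == z then f@_m else 0.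
Proof. by case: z => e /=; rewrite ?mcoeff0 // mcoeff_pihomog. Qed.

Lemma hpart_is_linear z : linear (hpart z).
Proof.
move=> a f g; apply/mpolyP => m; rewrite mcoeffD mcoeffZ !mcoeff_hpart.
by case: ifP => _; rewrite ?mcoeffD ?mcoeffZ // mulr0 addr0.
Qed.

HB.instance Definition _ z := GRing.isLinear.Build k S S _ (hpart z) (hpart_is_linear z).

Definition shomog (a : int) (f : S) := forall m, m \in msupp f -> a = (mdeg m)%:Z.

Lemma shomogP (e : nat) f : f \is e.-homog <-> shomog e f.
Proof.
split=> [/dhomogP h m /h -> //|h]; apply/dhomogP => m /h /eqP.
by rewrite eqz_nat eq_sym => /eqP.
Qed.

Lemma hpart_shomog z f : shomog z (hpart z f).
Proof.
by move=> m; rewrite mcoeff_msupp mcoeff_hpart; case: ifP => [/eqP ->|]; rewrite ?eqxx.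
Qed.

Lemma hpart_id z f : shomog z f -> hpart z f = f.
Proof.
move=> h; apply/mpolyP => m; rewrite mcoeff_hpart; case: eqP => // ne.
by apply/esym/memN_msupp_eq0/negP => /h e; apply: ne; rewrite e.
Qed.

Lemma hpartMr z a (f g : S) : shomog a g -> hpart z (f * g) = hpart (z - a) f * g.
Proof.
move=> hg; apply/mpolyP => m; rewrite mcoeff_hpart !mcoeffM.
have E (x : 'X_{1..n < (mdeg m).+1, (mdeg m).+1}) : m == (x.1 + x.2)%MM ->
    (hpart (z - a) f)@_x.1 * g@_x.2 =
    if (mdeg m)%:Z == z then f@_x.1 * g@_x.2 else 0.
  move=> /eqP em; rewrite mcoeff_hpart.
  have [/hg ea|gx] := boolP (bmnm x.2 \in msupp g); last first.
    by rewrite (memN_msupp_eq0 gx) !mulr0; case: ifP.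
  have aux (D D1 D2 : nat) : D = (D1 + D2)%N -> (D%:Z == z) = (D1%:Z == z - D2%:Z).
    by move=> ->; rewrite PoszD [RHS]eq_sym subr_eq eq_sym.
  rewrite (aux _ (mdeg x.1) (mdeg x.2)) -?ea; last by rewrite -mdegD -em.
  by case: ifP; rewrite ?mul0r.
rewrite (eq_bigr _ E); case: ifP => _; last by rewrite big1_eq.
by [].
Qed.

Lemma hpartXS (e : nat) j (f : S) : hpart e.+1 ('X_j * f) = 'X_j * hpart e f.
Proof.
rewrite mulrC [RHS]mulrC (hpartMr _ _ (a := 1)); first by congr (hpart _ _ * _); lia.
by move=> m; rewrite msuppX inE => /eqP->; rewrite mdeg1.
Qed.

End GradedParts.
Arguments hpart : simpl never.

(** * Division by the variables and bases of graded pieces *)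

Section MaximalIdealParts.
Local Open Scope ring_scope.
Variables (k : fieldType) (n : nat).
Local Notation S := {mpoly k[n]}.

(** Each nonconstant monomial is charged to a single variable dividing it, so no monomial is counted
    twice. *)
Definition xquot (j : 'I_n) (f : S) : S :=
  \sum_(m <- msupp f | [pick i | (0 < m i)%N] == Some j) f@_m *: 'X_[m - U_(j)].

Lemma xquotE f : f = (f@_0)%:MP + \sum_j 'X_j * xquot j f.
Proof.
rewrite {1}[f]mpolyE.
have -> : \sum_j 'X_j * xquot j f =
    \sum_(m <- msupp f) (if m == 0%MM then 0 else f@_m *: 'X_[m]).
  pose G (j : 'I_n) (m : 'X_{1..n}) := if [pick i | (0 < m i)%N] == Some j
    then 'X_j * (f@_m *: 'X_[m - U_(j)]) else 0 : S.
  rewrite (eq_bigr (fun j => \sum_(m <- msupp f) G j m)) => [|j _]; last first.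
    by rewrite /xquot mulr_sumr big_mkcond.
  rewrite exchange_big; apply: eq_bigr => m _ /=; rewrite /G.
  case: pickP => [j mj|m0]; last first.
    rewrite ifT ?big1 //; apply/eqP/mnmP => i; rewrite mnm0E.
    by have := m0 i; rewrite lt0n => /negbFE/eqP.
  rewrite ifF; last by apply: contraTF mj => /eqP->; rewrite mnm0E.
  rewrite (bigD1 j) //= eqxx big1 ?addr0 => [|i /negPf ij]; last first.
    by rewrite ifF //; apply/eqP => -[e]; rewrite e eqxx in ij.
  by rewrite -scalerAr -mpolyXD addmC submK // lep1mP -lt0n.
rewrite [X in X + _](_ : _ = \sum_(m <- msupp f) (if m == 0%MM then f@_m *: 'X_[m] else 0)).
  by rewrite -big_split; apply: eq_bigr => m _ /=; case: ifP; rewrite ?addr0 ?add0r.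
rewrite -big_mkcond /=; have [h|h] := boolP (0%MM \in msupp f).
  rewrite (big_rem _ h) /= eqxx big1_seq ?addr0 => [|m /andP[/eqP->]].
    by rewrite mpolyX0 alg_mpolyC.
  by rewrite mem_rem_uniq ?msupp_uniq // inE eqxx.
rewrite (memN_msupp_eq0 h) mpolyC0 big1_seq // => m /andP[/eqP->].
by rewrite (negPf h).
Qed.

Lemma row_xquot p q (u : 'M[S]_(p, q)) : cfmx 0 u = 0 ->
  u = \sum_j 'X_j *: map_mx (xquot j) u.
Proof.
move=> /matrixP u0; apply/matrixP => i l; rewrite summxE [LHS]xquotE.
have := u0 i l; rewrite !mxE => ->; rewrite mpolyC0 add0r.
by apply: eq_bigr => j _; rewrite !mxE.
Qed.

Lemma cfmx0_homog g p q (u : 'M[S]_(p, q)) : (0 < g)%N -> homogmx g u -> cfmx 0 u = 0.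
Proof.
move=> g0 hu; apply/matrixP => r l; rewrite !mxE; apply/memN_msupp_eq0/negP.
by move/(dhomog_mf (hu r l)) => /= e; rewrite -e mdeg0 in g0.
Qed.

(** Independence over the field only: relations with polynomial coefficients are allowed. *)
Definition indep_rows q p (D : 'M[S]_(q, p)) :=
  forall la : 'rV[k]_q, map_mx (@mpolyC n k) la *m D = 0 -> la = 0.

Lemma indep_rows_bound g q p (D : 'M[S]_(q, p)) : homogmx g D -> indep_rows D ->
  (q <= #|{: 'I_p * 'X_{1..n < g.+1}}|)%N.
Proof.
move=> hD iD; pose X : finType := ('I_p * 'X_{1..n < g.+1})%type.
pose M : 'M[k]_(q, #|X|) :=
  \matrix_(r, x) (let y : X := enum_val x in (D r y.1)@_(y.2)).
suff /row_freeP[B MB] : row_free M by apply: (mulmx1_min MB).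
apply/inj_row_free => la laM; apply: iD; apply/rowP => l.
apply/mpolyP => m; rewrite [in RHS]mxE mcoeff0.
have E : ((map_mx (@mpolyC n k) la *m D) 0 l)@_m = \sum_r la 0 r * (D r l)@_m.
  by rewrite mxE raddf_sum; apply: eq_bigr => r _; rewrite /= mxE mcoeffCM.
rewrite E; have [mg|mg] := ltnP (mdeg m) g.+1; last first.
  rewrite big1 // => r _; rewrite (dhomog_nemf_coeff (hD r l)) ?mulr0 //.
  by rewrite neq_ltn mg orbT.
have /rowP/(_ (enum_rank ((l, BMultinom mg) : X))) := laM.
rewrite mxE [RHS]mxE => e; rewrite -[RHS]e.
by apply: eq_bigr => r _; rewrite mxE enum_rankK.
Qed.

(** A maximal independent family spans, and a maximum exists because rows of degree [g] live in a
    finite-dimensional space. *)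
Lemma homog_row_basis g p (Z : 'rV[S]_p -> Prop) :
  Z 0 -> (forall f u v, Z u -> Z v -> Z (f *: u + v)) ->
  exists q (D : 'M[S]_(q, p)), [/\ homogmx g D, indep_rows D,
    forall v : 'rV_q, Z (v *m D)
    & forall u, Z u -> homogmx g u -> exists la, u = map_mx (@mpolyC n k) la *m D].
Proof.
move=> Z0 Zlin.
pose P q := `[< exists D : 'M[S]_(q, p), [/\ homogmx g D, indep_rows D
    & forall r, Z (row r D)] >].
have P0 : exists q, P q.
  exists 0%N; apply/asboolP; exists 0; split=> [i|la _|i]; try by case: i.
  by apply/rowP => -[].
have Pb q : P q -> (q <= #|{: 'I_p * 'X_{1..n < g.+1}}|)%N.
  by move=> /asboolP[D [hD iD _]]; apply: indep_rows_bound hD iD.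
case: (ex_maxnP P0 Pb) => q /asboolP[D [hD iD ZD]] qmax; exists q, D.
have ZvD v : Z (v *m D).
  rewrite mulmx_sum_row; elim/big_ind: _ => // [u w hu hw|r _].
    by rewrite -[u]scale1r; apply: Zlin.
  by rewrite -[_ *: _]addr0; apply: Zlin.
split=> // u Zu hu; apply: contrapT => nu.
suff /qmax : P q.+1 by rewrite ltnn.
have -> : q.+1 = (q + 1)%N by rewrite addn1.
apply/asboolP; exists (col_mx D u); split.
- by move=> r l; rewrite mxE; case: splitP => r' _; [apply: hD|rewrite ord1; apply: hu].
- move=> la; rewrite -[la]hsubmxK map_row_mx mul_row_col => e.
  set l1 := lsubmx la in e *; set l2 := rsubmx la in e *.
  have l20 : l2 0 0 = 0.
    apply/eqP; apply: contrapT => /negP l2n; apply: nu.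
    exists (- (l2 0 0)^-1 *: l1); rewrite map_mxZ -scalemxAl.
    have -> : map_mx (@mpolyC n k) l1 *m D = - ((l2 0 0)%:MP *: u).
      apply/eqP; rewrite -addr_eq0 -[X in _ == X]e; apply/eqP; congr (_ + _).
      rewrite [l2]mx11_scalar map_scalar_mx mul_scalar_mx.
      by rewrite !mxE.
    by rewrite scalerN scalerA -mpolyCM mulNr mulVf // mpolyCN mpolyC1 scaleN1r opprK.
  have l20' : l2 = 0 by apply/rowP => z; rewrite ord1 l20 mxE.
  move: e; rewrite l20' map_mx0 mul0mx addr0 => /iD->.
  by rewrite row_mx0.
- move=> r; have := splitP r; case=> r' er.
    have -> : r = lshift 1 r' by apply/val_inj.
    by rewrite rowKu.
  have -> : r = rshift q r' by apply/val_inj.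
  by rewrite rowKd row_id.
Qed.

End MaximalIdealParts.

(** * Comparison of the linear complex with the given resolution *)

Section LinearPart.
Local Open Scope ring_scope.
Variables (k : fieldType) (n d c : nat).
Local Notation S := {mpoly k[n]}.
Variables (I : {pred S}) (F : graded_free_seq k n).
Hypothesis hI : idealr_closed I.
Hypothesis hF : graded_free_resolution F I.
Hypothesis hN : condition_N F d c.

Lemma fdiff_comp i : fdiff F i.+1 *m fdiff F i = 0.
Proof.
case: hF => _ _ _ _ ex; apply/row_matrixP => r; rewrite row_mul row0.
by apply/ex; exists (row r 1%:M); rewrite -row_mul mul1mx.
Qed.

Lemma ideal_mull f g : g \in I -> f * g \in I.
Proof. by case: hI => I0 _ cl gI; rewrite -[_ * _]addr0 cl. Qed.

Definition xmul p (Z : 'rV[S]_p -> Prop) (u : 'rV[S]_p) :=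
  exists w : 'I_n -> 'rV[S]_p, (forall j, Z (w j)) /\ u = \sum_j 'X_j *: w j.

(* A linear complex M_i -> ... -> M_0 exact below M_i is compared with F:
   [Z] is the module of cycles of M_i, a free module on p generators of degree e;
   [al] and [be] are the components at i of comparison maps M -> F and F -> M
   and [be \o al] is homotopic to the identity, which on [Z] leaves an error
   term [tau] with values in [Z]. *)
Record comparison i p (Z : 'rV[S]_p -> Prop) (al : 'M[S]_(p, frank F i))
    (be : 'M[S]_(frank F i, p)) (e g : nat) : Prop := Comparison {
  cmp_lin : forall f u v, Z u -> Z v -> Z (f *: u + v);
  cmp_part : forall j u, Z u -> Z (map_mx (hpart j) u);
  cmp_low : forall u j, Z u -> (j < g)%N -> homogmx j u -> u = 0;
  cmp_al_homog : forall r l, shomog (e%:Z - fdeg l) (al r l);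
  cmp_al : forall u, Z u -> exists v, u *m al = v *m fdiff F i;
  cmp_be : forall y, Z (y *m fdiff F i *m be);
  cmp_tau : exists tau, (forall y, Z (y *m tau)) /\
    forall u, Z u -> u *m al *m be = u + u *m tau }.

Section Step.
Variables (i p : nat) (Z : 'rV[S]_p -> Prop) (al : 'M[S]_(p, frank F i)).
Variables (be : 'M[S]_(frank F i, p)) (e g : nat).
Hypothesis cmp : comparison Z al be e g.
Hypotheses (g_gt0 : (0 < g)%N) (eg : (e + g = d + i)%N) (ic : (i < c)%N).

Let Zlin := cmp_lin cmp.

Lemma cycles0 : Z 0.
Proof. by have := cmp_be cmp 0; rewrite !mul0mx. Qed.

(** Subtracting a boundary from [y] gives a lift y' that vanishes modulo the variables. Then z = y'
    [fdiff F i] [be] - z tau, and pulling variables out of y' and z leaves factors in [Z]. *)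
Lemma xmul_of_boundary z y : Z z -> cfmx 0 z = 0 -> z *m al = y *m fdiff F i ->
  (cfmx 0 y <= kdiff F i.+1)%MS -> xmul Z z.
Proof.
move=> Zz z0 ezy /submxP[la ela].
pose y' := y - map_mx (@mpolyC n k) la *m fdiff F i.+1.
have y'0 : cfmx 0 y' = 0 by rewrite cfmxB cfmx_Cmul ela subrr.
have ey : y' *m fdiff F i = z *m al.
  by rewrite mulmxBl -mulmxA fdiff_comp mulmx0 subr0.
have [tau [Ztau etau]] := cmp_tau cmp.
have ez : z = z *m al *m be - z *m tau by rewrite etau // addrK.
exists (fun j => map_mx (xquot j) y' *m fdiff F i *m be - map_mx (xquot j) z *m tau); split.
  move=> j; rewrite addrC -scaleN1r; apply: Zlin; first exact: Ztau.
  exact: cmp_be cmp _.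
rewrite {1}ez -ey {1}(row_xquot y'0) {1}(row_xquot z0) !mulmx_suml -sumrB.
by apply: eq_bigr => j _; rewrite scalerBr -!scalemxAl.
Qed.

Lemma homog_lift (E : int) w v : w = v *m fdiff F i ->
  (forall l, shomog (E - fdeg l) (w 0 l)) ->
  exists2 v' : 'rV_(frank F i.+1), w = v' *m fdiff F i &
    forall r, shomog (E - fdeg r) (v' 0 r).
Proof.
move=> ew hw; exists (\row_r hpart (E - fdeg r) (v 0 r)); last first.
  by move=> r; rewrite mxE; apply: hpart_shomog.
apply/rowP => l; rewrite -(hpart_id (hw l)) ew !mxE raddf_sum.
apply: eq_bigr => r _; rewrite /= mxE; case: hF => _ hd _ _ _.
have hh : shomog (fdeg r - fdeg l) (fdiff F i r l).
  by move=> m /hd ->; rewrite addrAC subrr add0r.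
by rewrite (hpartMr _ _ hh); congr (hpart _ _ * _); ring.
Qed.

(* Graded Nakayama: by condition N, cycles of degree above [e + g] lie in the maximal ideal
   times [Z]. *)
Lemma cycles_generated q (D : 'M[S]_(q, p)) :
  (forall u, Z u -> homogmx g u -> exists la, u = map_mx (@mpolyC n k) la *m D) ->
  forall u, Z u -> exists v, u = v *m D.
Proof.
move=> hD.
suff H j u : Z u -> homogmx j u -> exists v, u = v *m D.
  move=> u Zu; pose B := \max_(l < p) msize (u 0%R l).
  have -> : u = \sum_(j < B) map_mx (hpart j) u.
    apply/rowP => l; rewrite summxE {1}(@pihomog_partitionE _ _ mdeg B (u 0 l)).
      by apply: eq_bigr => j _; rewrite mxE.
    by rewrite /B (leq_bigmax l).
  elim/big_ind: _ => // [|a b [v ->] [w ->]|j _].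
  - by exists 0; rewrite mul0mx.
  - by exists (v + w); rewrite mulmxDl.
  apply: (H j); first exact: (cmp_part cmp).
  by move=> r l; rewrite mxE; apply: pihomogP.
elim: j u => [|j IH] u Zu hu.
  by rewrite (cmp_low cmp Zu g_gt0 hu); exists 0; rewrite mul0mx.
have [lt|] := ltnP j.+1 g; first by rewrite (cmp_low cmp Zu lt hu); exists 0; rewrite mul0mx.
rewrite leq_eqVlt => /orP[/eqP ej|gj].
  by have [|la ->] := hD u Zu; [rewrite ej | exists (map_mx (@mpolyC n k) la)].
have u0 : cfmx 0 u = 0 by apply: cfmx0_homog hu.
have [v ev] := cmp_al cmp Zu.
have [|y ey hy] := @homog_lift (e + j.+1)%N%:Z _ _ ev.
  move=> l; rewrite mxE => m /msupp_sum_le /flatten_mapP[r _].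
  move=> /msuppM_le /allpairsP[[a b] /= [ha hb ->]].
  have := cmp_al_homog cmp hb; have /shomogP := hu 0 r => /(_ _ ha).
  by rewrite mdegD !PoszD => -> <-; ring.
have ycyc : (cfmx 0 y <= kcycles F i.+1 :&: kdegree F i.+1 (e + j.+1)%N%:Z)%MS.
  rewrite sub_capmx; apply/andP; split.
    apply/sub_kermxP; rewrite /kdiff -/(cfmx 0 _).
    have -> : cfmx 0 y *m cfmx 0 (fdiff F i) = cfmx 0 (y *m fdiff F i).
      by rewrite /cfmx map_mxM.
    rewrite -ey -[u]mulmx1 -mulmxA mul1mx.
    apply: cfmx_mul_eq0 => m /mnm_lepP le; have -> : m = 0%MM; last by [].
    by apply/mnmP => z; have := le z; rewrite mnm0E leqn0 => /eqP.
  apply/submxP; exists (cfmx 0 y); rewrite /kdegree mul_mx_diag.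
  apply/rowP => r; rewrite !mxE; case: eqP => [_|ne]; first by rewrite mulr1.
  rewrite mulr0; apply: memN_msupp_eq0; apply/negP => /hy; rewrite mdeg0 => /eqP.
  by rewrite subr_eq0 => /eqP e'; apply: ne.
(* Condition N at i + 1 allows degrees up to d + i = e + g only, and g < j + 1. *)
have gb0 : graded_betti F i.+1 (e + j.+1)%N%:Z = 0%N.
  apply/eqP; apply: contraT => ne; have [|_ htop] := hN (i := i.+1); first by rewrite ic.
  have := htop _ ne; lia.
have yk : (cfmx 0 y <= kdiff F i.+1)%MS.
  apply: submx_trans ycyc _; apply: submx_trans (capmxSl _ (kdegree F i.+1 (e + j.+1)%N%:Z)).
  move/eqP: gb0; rewrite /graded_betti mxrank_eq0 => /eqP gb0.
  rewrite -(addsmx_diff_cap_eq _ (kdiff F i.+1 :&: kdegree F i.+1 (e + j.+1)%N%:Z)%MS).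
  by rewrite gb0 adds0mx capmxSr.
have [w [Zw ew]] := xmul_of_boundary Zu u0 ey yk.
(* The cofactors [w l] may be inhomogeneous, but their parts of degree [j] still lie in [Z]. *)
have -> : u = \sum_l 'X_l *: map_mx (hpart j) (w l).
  apply/rowP => l; rewrite summxE; have /shomogP/hpart_id <- := hu 0 l.
  rewrite ew summxE raddf_sum; apply: eq_bigr => x _; rewrite !mxE.
  exact: hpartXS.
elim/big_ind: _ => // [|a b [v' ->] [w' ->]|l _].
- by exists 0; rewrite mul0mx.
- by exists (v' + w'); rewrite mulmxDl.
have [||v' ->] := IH (map_mx (hpart j) (w l)).
- exact: (cmp_part cmp).
- by move=> r x; rewrite mxE; apply: pihomogP.
by exists ('X_l *: v'); rewrite scalemxAl.
Qed.

(** The next module is free on a basis of the degree [g] part of [Z]. It embeds in Tor: a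
    combination that becomes a boundary lies in the maximal ideal times [Z] by [xmul_of_boundary],
    and that has nothing in degree [g]. Independence over the field makes the kernel of [D] start in
    degree 1. *)
Lemma comparison_step : exists q (D : 'M[S]_(q, p)) al' be',
  [/\ homogmx g D, forall u, Z u <-> (exists v, u = v *m D), (q <= betti F i.+1)%N
    & @comparison i.+1 q (fun u => u *m D = 0) al' be' (e + g) 1].
Proof.
have [q [D [hD iD ZD span]]] := homog_row_basis g cycles0 Zlin.
have genD := cycles_generated span.
have ZE u : Z u <-> (exists v, u = v *m D).
  by split=> [/genD //|[v ->]]; apply: ZD.
have alx r : exists v : 'rV_(frank F i.+1), row r (D *m al) = v *m fdiff F i /\
    forall l, shomog ((e + g)%N%:Z - fdeg l) (v 0 l).
  have [v ev] := cmp_al cmp (ZD (row r 1%:M)).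
  rewrite -row_mul mul1mx -row_mul in ev.
  have [|v' ev' hv'] := @homog_lift (e + g)%N%:Z _ _ ev; last by exists v'.
  move=> l; rewrite !mxE => m /msupp_sum_le /flatten_mapP[x _].
  move=> /msuppM_le /allpairsP[[a b] /= [ha hb ->]].
  have := cmp_al_homog cmp hb; have /shomogP := hD r x => /(_ _ ha).
  by rewrite mdegD !PoszD => -> <-; ring.
have [fal hal] := choice alx.
pose al' : 'M[S]_(q, frank F i.+1) := \matrix_r fal r.
have eal : D *m al = al' *m fdiff F i.
  by apply/row_matrixP => r; rewrite [RHS]row_mul rowK; case: (hal r).
have bex r : exists v : 'rV_q, row r (fdiff F i *m be) = v *m D.
  apply/ZE; have := cmp_be cmp (row r 1%:M).
  by rewrite -row_mul mul1mx -row_mul.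
have [fbe hbe] := choice bex; pose be' : 'M[S]_(frank F i.+1, q) := \matrix_r fbe r.
have ebe : fdiff F i *m be = be' *m D.
  by apply/row_matrixP => r; rewrite [RHS]row_mul rowK.
have [tau [Ztau etau]] := cmp_tau cmp.
have taux r : exists v : 'rV_q, row r tau = v *m D.
  by apply/ZE; have := Ztau (row r 1%:M); rewrite -row_mul mul1mx.
have [ft hft] := choice taux; pose tt : 'M[S]_(p, q) := \matrix_r ft r.
have ett : tau = tt *m D by apply/row_matrixP => r; rewrite row_mul rowK.
have eDab : D *m al *m be = D + D *m tau.
  apply/row_matrixP => r; have := etau _ (ZD (row r 1%:M)).
  by rewrite -!row_mul mul1mx => ->; rewrite raddfD.
exists q, D, al', be'; split=> //.
  have inj (la : 'rV[k]_q) : (la *m cfmx 0 al' <= kdiff F i.+1)%MS -> la = 0.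
    move=> sub; apply: iD; set z := _ *m D.
    have hz : homogmx g z.
      move=> r l; rewrite mxE; apply: rpred_sum => x _; rewrite mxE mul_mpolyC.
      by apply: rpredZ; apply: hD.
    have Zz : Z z by apply: ZD.
    have z0 : cfmx 0 z = 0 by apply: cfmx0_homog hz.
    have [||w [Zw ew]] := xmul_of_boundary (y := map_mx (@mpolyC n k) la *m al') Zz z0.
      by rewrite -!mulmxA eal.
      by rewrite cfmx_Cmul.
    have e1 : z = \sum_l 'X_l *: map_mx (hpart g.-1) (w l).
      apply/rowP => l; rewrite summxE; have /shomogP/hpart_id <- := hz 0 l.
      rewrite ew summxE raddf_sum; apply: eq_bigr => x _; rewrite !mxE.
      by rewrite -hpartXS prednK.
    rewrite e1 big1 // => l _; suff -> : map_mx (hpart g.-1) (w l) = 0 by rewrite scaler0.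
    have lt : (g.-1 < g)%N by rewrite prednK.
    apply: (cmp_low cmp _ lt); first exact: (cmp_part cmp).
    by move=> r x; rewrite mxE; apply: pihomogP.
  have free : row_free (cfmx 0 al').
    by apply/inj_row_free => la e0; apply: inj; rewrite e0 sub0mx.
  have cyc : (cfmx 0 al' <= kcycles F i.+1)%MS.
    apply/sub_kermxP; rewrite /kdiff /cfmx -map_mxM -eal.
    apply: cfmx_mul_eq0 => m /mnm_lepP le.
    have -> : m = 0%MM by apply/mnmP => z; have := le z; rewrite mnm0E leqn0 => /eqP.
    exact: cfmx0_homog hD.
  have cap0 : (cfmx 0 al' :&: kdiff F i.+1 = 0)%MS.
    apply/eqP; rewrite -submx0; apply/row_subP => r.
    have := row_sub r (cfmx 0 al' :&: kdiff F i.+1)%MS.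
    rewrite sub_capmx => /andP[/submxP[la ela] sk].
    by rewrite ela (inj la) ?mul0mx ?sub0mx // -ela.
  have le2 : (cfmx 0 al' + kdiff F i.+1 <= kcycles F i.+1)%MS.
    rewrite addsmx_sub cyc; apply/sub_kermxP.
    by rewrite /kdiff -map_mxM fdiff_comp map_mx0.
  rewrite /betti; have := mxrank_cap_compl (kcycles F i.+1) (kdiff F i.+1).
  have := mxrankS le2; have := mxrank_sum_cap (cfmx 0 al') (kdiff F i.+1).
  rewrite cap0 mxrank0 addn0 => ->.
  have := mxrankS (capmxSr (kcycles F i.+1) (kdiff F i.+1)).
  move/eqP: free => ->; lia.
split.
- by move=> f u v hu hv; rewrite mulmxDl -scalemxAl hu hv scaler0 addr0.
- move=> j u hu; apply/rowP => l; rewrite [RHS]mxE.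
  have := congr1 (fun w : 'rV_p => hpart (j + g%:Z) (w 0 l)) hu.
  rewrite !mxE raddf0 raddf_sum /= => e0; rewrite -[RHS]e0.
  apply: eq_bigr => r _; rewrite mxE (@hpartMr _ _ _ g%:Z); last exact/shomogP.
  by rewrite addrK.
- move=> u j hu; rewrite ltnS leqn0 => /eqP-> h0.
  have eu : u = map_mx (@mpolyC n k) (cfmx 0 u).
    apply/rowP => l; rewrite !mxE; apply: msize1_polyC.
    rewrite msizeE; apply/bigmax_leqP_seq => m ms _.
    by rewrite (dhomog_mf (h0 0 l) ms).
  have c0 : cfmx 0 u = 0 by apply: iD; rewrite -eu.
  by rewrite eu c0 map_mx0.
- by move=> r l; rewrite mxE; case: (hal r) => _; apply.
- case: hF => _ _ _ _ ex u uD; apply/ex.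
  by rewrite -mulmxA -eal mulmxA uD mul0mx.
- by move=> y; rewrite -mulmxA -ebe -mulmxA [fdiff _ _ *m (_ *m _)]mulmxA fdiff_comp mul0mx mulmx0.
(* Subtracting [D *m tt] changes nothing on the kernel of [D], and it makes all values of the error
   term land in that kernel. *)
exists (al' *m be' - 1%:M - D *m tt); split=> [y|u uD].
  rewrite -mulmxA !mulmxBl mul1mx -!mulmxA -ebe -ett [al' *m _]mulmxA -eal eDab.
  by rewrite [D + _]addrC addrK subrr mulmx0.
rewrite !mulmxBr mulmx1 -!mulmxA [u *m (D *m _)]mulmxA uD mul0mx subr0.
by rewrite addrCA subrr addr0.
Qed.

End Step.
End LinearPart.

Section LinearStrandExists.
Local Open Scope ring_scope.
Variables (k : fieldType) (n d c : nat).
Local Notation S := {mpoly k[n]}.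
Variables (I : {pred S}) (F : graded_free_seq k n).
Hypothesis d_gt0 : (0 < d)%N.
Hypothesis c_gt0 : (0 < c)%N.
Hypothesis hI : idealr_closed I.
Hypothesis hhom : homogeneous_ideal I.
Hypothesis hgen : generated_in_degree d I.
Hypothesis hF : graded_free_resolution F I.
Hypothesis hN : condition_N F d c.

Lemma hpart_ideal z f : f \in I -> hpart z f \in I.
Proof.
case: hI => I0 _ _; case: z => e fI /=; last exact: I0.
exact: hhom.
Qed.

Lemma ideal_low f j : f \in I -> (j < d)%N -> f \is j.-homog -> f = 0.
Proof.
move=> /hgen[s [hs ->]] jd /shomogP/hpart_id <-; rewrite raddf_sum /=.
apply: big1_seq => -[a g] /= /hs[_ hg].
have /shomogP hg' := hg; rewrite (hpartMr _ _ hg').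
suff -> : (j%:Z - d%:Z = Negz (d - j).-1)%R by rewrite mul0r.
by rewrite NegzE prednK ?subn_gt0 // -subzn ?(ltnW jd) // opprB.
Qed.

(** The complex starts with M_0 = S and cycles [I]: [al] lifts 1 to degree 0 of F_0, and the error
    [al *m faug F - 1] lies in [I]. *)
Lemma comparison_init : exists al,
  @comparison k n F 0 1 (fun u => u 0 0 \in I) al (faug F) 0 d.
Proof.
have [I0 I1 Icl] := hI; case: (hF) => haug hdiff [u hu] ex0 ex.
pose al : 'rV[S]_(frank F 0) := \row_l hpart (0 - fdeg l) (u 0 l).
have hal : (al *m faug F) 0 0 - 1 \in I.
  have -> : (al *m faug F) 0 0 - 1 = hpart 0 ((u *m faug F) 0 0 - 1).
    rewrite raddfB /= (@hpart_id _ _ 0 1); last first.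
      by move=> m; rewrite msupp1 inE => /eqP->; rewrite mdeg0.
    congr (_ - _); rewrite !mxE raddf_sum; apply: eq_bigr => l _; rewrite /= mxE.
    by rewrite (@hpartMr _ _ _ (fdeg l)) // => m /haug.
  exact: hpart_ideal.
exists al; split.
- by move=> f v w hv hw; rewrite !mxE; apply: Icl.
- by move=> j v hv; rewrite mxE; apply: hpart_ideal.
- move=> v j hv jd hj; apply/rowP => l; rewrite [RHS]mxE ord1.
  exact: ideal_low (hj 0 0).
- by move=> r l; rewrite ord1 mxE; apply: hpart_shomog.
- move=> v hv; apply/ex0; rewrite -mulmxA [v]mx11_scalar mul_scalar_mx mxE mulrC.
  by apply: ideal_mull.
- by move=> y; apply/ex0; exists y.
exists (al *m faug F - 1%:M); split=> [y|v hv].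
  rewrite [y]mx11_scalar mul_scalar_mx mxE; apply: ideal_mull => //.
  by rewrite [X in X \in I]mxE [X in _ + X]mxE [X in _ - X]mxE eqxx.
by rewrite mulmxBr mulmx1 mulmxA addrCA subrr addr0.
Qed.

(** Data without properties, so that a total recursion can build all modules; beyond the range of
    condition N they are arbitrary. *)
Record cstate i := CState {
  cs_rank : nat;
  cs_cycles : 'rV[S]_cs_rank -> Prop;
  cs_al : 'M[S]_(cs_rank, frank F i);
  cs_be : 'M[S]_(frank F i, cs_rank) }.

Definition cs_good i (s : cstate i) e g := comparison (@cs_cycles _ s) (cs_al s) (cs_be s) e g.

Lemma linear_strand : exists (b : nat -> nat) (D0 : 'cV[S]_(b 0%N))
    (D : forall i, 'M[S]_(b i.+1, b i)),
  [/\ homogmx d D0, forall f, f \in I <-> (exists v : 'rV_(b 0%N), f = (v *m D0) 0 0),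
      forall i, (i.+1 < c)%N -> homogmx 1 (D i),
      forall i, (i < c)%N -> (b i <= betti F i.+1)%N
    & ((1 < c)%N -> forall u : 'rV_(b 0%N), u *m D0 = 0 <-> (exists v, u = v *m D 0%N)) /\
      (forall i, (i.+2 < c)%N -> forall u : 'rV_(b i.+1),
         u *m D i = 0 <-> (exists v, u = v *m D i.+1))].
Proof.
have [al0 cmp0] := comparison_init.
have [q0 [D0 [al1 [be1 [hD0 genD0 lq0 cmp1]]]]] :=
  comparison_step hF hN cmp0 d_gt0 (addnC 0%N d) c_gt0.
pose T j (s : cstate j.+1) := {q : nat & ('M[S]_(q, cs_rank s) *
  ('M[S]_(q, frank F j.+2) * 'M[S]_(frank F j.+2, q)))%type}.
pose mk j (s : cstate j.+1) (x : T j s) : cstate j.+2 :=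
  @CState j.+2 (projT1 x) (fun u => u *m (projT2 x).1 = 0) (projT2 x).2.1 (projT2 x).2.2.
pose good j (s : cstate j.+1) := (j < c)%N -> cs_good s (d + j) 1.
have nx j (s : cstate j.+1) : {x : T j s | good j s -> (j.+1 < c)%N ->
    [/\ homogmx 1 (projT2 x).1, forall u, cs_cycles u <-> (exists v, u = v *m (projT2 x).1),
      (projT1 x <= betti F j.+2)%N & good j.+1 (mk j s x)]}.
  apply: cid; have [[hg hj]|nh] := pselect (good j s /\ (j.+1 < c)%N); last first.
    exists (existT _ 0%N (0, (0, 0))) => hg hj; by case: nh.
  have [|q [D [al' [be' [h1 h2 h3 h4]]]]] :=
      comparison_step hF hN (hg (ltnW hj)) (ltn0Sn 0) _ hj; first by rewrite addn1 addnS.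
  exists (existT _ q (D, (al', be'))) => _ _; split=> // _.
  by move: h4; rewrite /= addn1 addnS.
pose s1 : cstate 1 := @CState 1 q0 (fun u => u *m D0 = 0) al1 be1.
pose SS := nat_rect (fun j => cstate j.+1) s1 (fun j s => mk j s (sval (nx j s))).
pose b j := cs_rank (SS j).
pose D j : 'M[S]_(b j.+1, b j) := (projT2 (sval (nx j (SS j)))).1.
have gS j : good j (SS j).
  elim: j => [|j IH] hj; first by move: cmp1; rewrite /cs_good addn0.
  by have [_ _ _ h] := svalP (nx j (SS j)) IH hj; apply: h.
exists b, D0, D; split=> //.
- move=> f; have := genD0 (f%:M); rewrite mxE eqxx mulr1n => ->.
  split=> -[v ev]; exists v; first by rewrite -ev mxE eqxx.
  by rewrite [RHS]mx11_scalar ev.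
- by move=> i hi; have [h _ _ _] := svalP (nx i (SS i)) (gS i) hi.
- case=> [_ //|i hi]; by have [_ _ h _] := svalP (nx i (SS i)) (gS i) hi.
split=> [hc u|i hi u].
  by have [_ h _ _] := svalP (nx 0%N (SS 0%N)) (gS 0%N) hc; exact (h u).
by have [_ h _ _] := svalP (nx i.+1 (SS i.+1)) (gS i.+1) hi; exact (h u).
Qed.

End LinearStrandExists.

(** * Null-homotopies on a complex of free modules *)

Section Homotopies.
Local Open Scope ring_scope.
Variables (R : comNzRingType) (c' : nat) (b : nat -> nat).
Variables (D0 : 'cV[R]_(b 0%N)) (D : forall i, 'M[R]_(b i.+1, b i)).

(* The complex is R^(b c') -> ... -> R^(b 1) -> R^(b 0) -> R, with last map [D0]. *)
Definition null_homotopic (a : R) :=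
  exists (s0 : 'rV[R]_(b 0%N)) (s : forall i, 'M[R]_(b i, b i.+1)),
    [/\ s0 *m D0 = a%:M, (0 < c')%N -> s 0%N *m D 0%N + D0 *m s0 = a%:M
      & forall i, (i.+1 < c')%N -> s i.+1 *m D i.+1 + D i *m s i = a%:M].

Lemma null_homotopicD a1 a2 :
  null_homotopic a1 -> null_homotopic a2 -> null_homotopic (a1 + a2).
Proof.
move=> [s0 [s [h0 h1 h2]]] [r0 [r [g0 g1 g2]]].
exists (s0 + r0), (fun i => s i + r i); split=> [|c0|i ic].
- by rewrite mulmxDl h0 g0 [RHS]raddfD.
- by rewrite mulmxDl mulmxDr addrACA h1 // g1 // [RHS]raddfD.
by rewrite mulmxDl mulmxDr addrACA h2 // g2 // [RHS]raddfD.
Qed.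

Lemma null_homotopicM x a : null_homotopic a -> null_homotopic (x * a).
Proof.
move=> [s0 [s [h0 h1 h2]]]; exists (x *: s0), (fun i => x *: s i).
split=> [|c0|i ic]; rewrite -scalemxAl ?h0 ?scale_scalar_mx //.
- by rewrite -scalemxAr -scalerDr h1 // scale_scalar_mx.
by rewrite -scalemxAr -scalerDr h2 // scale_scalar_mx.
Qed.

Lemma null_homotopic0 : null_homotopic 0.
Proof.
exists 0, (fun=> 0); split=> *; rewrite ?mul0mx ?mulmx0 ?addr0;
  by apply/esym/matrixP => i j; rewrite !mxE mul0rn.
Qed.

Hypothesis DD0 : (0 < c')%N -> D 0%N *m D0 = 0.
Hypothesis DD : forall i, (i.+1 < c')%N -> D i.+1 *m D i = 0.

Lemma exact_null_homotopic a :
  (exists s0 : 'rV_(b 0%N), s0 *m D0 = a%:M) ->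
  ((0 < c')%N -> forall u : 'rV_(b 0%N), u *m D0 = 0 -> exists v, u = v *m D 0%N) ->
  (forall i, (i.+1 < c')%N -> forall u : 'rV_(b i.+1),
     u *m D i = 0 -> exists v, u = v *m D i.+1) ->
  null_homotopic a.
Proof.
move=> [s0 es0] ex0 ex.
have rows i p (A : 'M[R]_(p, b i)) : (i < c')%N ->
    (forall u : 'rV_(b i), (exists r, u = row r A) -> exists v, u = v *m D i) ->
    exists B, B *m D i = A.
  move=> ic h; have /choice[f hf] : forall r, exists v, row r A = v *m D i.
    by move=> r; apply: h; exists r.
  by exists (\matrix_r f r); apply/row_matrixP => r; rewrite row_mul rowK.
have [sz esz] : exists sz : 'M_(b 0%N, b 1%N), (0 < c')%N -> sz *m D 0%N + D0 *m s0 = a%:M.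
  have [c0|nc] := boolP (0 < c')%N; last by exists 0.
  have [|sz esz] := @rows 0%N _ (a%:M - D0 *m s0) c0.
    move=> u [r ->]; apply: ex0 => //; rewrite -row_mul mulmxBl -mulmxA es0.
    by rewrite scalar_mxC subrr row0.
  by exists sz => _; rewrite esz subrK.
(* That [D i] kills a - D_i s_i depends on the earlier stages, so it is a premise of the choice,
   supplied afterwards by [inv]. *)
have nx i (s : 'M_(b i, b i.+1)) : {s' : 'M_(b i.+1, b i.+2) |
    (i.+1 < c')%N -> (a%:M - D i *m s) *m D i = 0 -> s' *m D i.+1 + D i *m s = a%:M}.
  apply: cid; have [ic|nc] := boolP (i.+1 < c')%N; last by exists 0.
  have [h|nh] := pselect ((a%:M - D i *m s) *m D i = 0); last by exists 0.
  have [|s' es'] := rows i.+1 _ (a%:M - D i *m s) ic.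
    by move=> u [r ->]; apply: ex => //; rewrite -row_mul h row0.
  by exists s' => _ _; rewrite es' subrK.
pose s := nat_rect (fun i => 'M[R]_(b i, b i.+1)) sz (fun i s => sval (nx i s)).
have inv i : (i < c')%N -> (a%:M - D i *m s i) *m D i = 0.
  elim: i => [|i IH] ic.
    rewrite mulmxBl -mulmxA -[s 0%N *m _](addrK (D0 *m s0)) esz // mulmxBr mulmxA DD0 //.
    by rewrite mul0mx subr0 scalar_mxC subrr.
  have e := svalP (nx i (s i)) ic (IH (ltnW ic)).
  rewrite mulmxBl -mulmxA -[s i.+1 *m _](addrK (D i *m s i)) e mulmxBr mulmxA DD //.
  by rewrite mul0mx subr0 scalar_mxC subrr.
exists s0, s; split=> // i ic.
exact: (svalP (nx i (s i)) ic (inv _ (ltnW ic))).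
Qed.

End Homotopies.

Section MapHomotopies.
Local Open Scope ring_scope.
Variables (R R' : comNzRingType) (th : {rmorphism R -> R'}) (c' : nat) (b : nat -> nat).
Variables (D0 : 'cV[R]_(b 0%N)) (D : forall i, 'M[R]_(b i.+1, b i)).

Lemma map_null_homotopic a : null_homotopic c' D0 D a ->
  null_homotopic c' (map_mx th D0) (fun i => map_mx th (D i)) (th a).
Proof.
move=> [s0 [s [h0 h1 h2]]]; exists (map_mx th s0), (fun i => map_mx th (s i)).
split=> [|c0|i ic]; rewrite -!map_mxM -?map_mxD.
- by rewrite h0 map_scalar_mx.
- by rewrite h1 // map_scalar_mx.
by rewrite h2 // map_scalar_mx.
Qed.

End MapHomotopies.

(** * Height and growth *)

Section Growth.
Local Open Scope ring_scope.

Lemma linear_dependency (K : fieldType) (X Y : finType) (M : X -> Y -> K) :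
  (#|Y| < #|X|)%N -> exists la : X -> K,
    (exists x, la x != 0) /\ forall y, \sum_x la x * M x y = 0.
Proof.
move=> ltYX; pose A : 'M[K]_(#|X|, #|Y|) := \matrix_(i, j) M (enum_val i) (enum_val j).
have : kermx A != 0.
  rewrite kermx_eq0 /row_free; apply/negP => /eqP e.
  by have := rank_leq_col A; rewrite e leqNgt ltYX.
case/rowV0Pn => v vA v0; exists (fun x => v 0 (enum_rank x)); split.
  have [j vj] : exists j, v 0 j != 0.
    apply/existsP; apply: contraNT v0 => /existsPn h; apply/eqP/rowP => j.
    by rewrite mxE; apply/eqP; rewrite -[_ == _]negbK h.
  by exists (enum_val j); rewrite enum_valK.
move=> y; move/sub_kermxP: vA => /rowP/(_ (enum_rank y)); rewrite !mxE => e.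
rewrite -[RHS]e (reindex (@enum_val X predT)) /=; last exact/onW_bij/enum_val_bij.
by apply: eq_bigr => j _; rewrite mxE !enum_valK enum_rankK.
Qed.

Lemma leq_expl a b e : (a <= b)%N -> (a ^ e <= b ^ e)%N.
Proof. by move=> ab; elim: e => // e IH; rewrite !expnS leq_mul. Qed.

Variables (k : fieldType) (n : nat).
Local Notation S := {mpoly k[n]}.
Implicit Types (C P I : {pred S}).

Definition free_mod C (X : finType) (s : X -> S) :=
  forall la : X -> k, \sum_x la x *: s x \in C -> forall x, la x = 0.

(* The dimension of the space of polynomials of degree at most D * J, modulo C,
   is at least J ^ r: the transcendence degree modulo C is at least r. *)
Definition grows C r := exists D, forall J, (0 < J)%N -> exists (X : finType) (s : X -> S),
  [/\ free_mod C s, forall x, (msize (s x) <= (D * J).+1)%N & (J ^ r <= #|X|)%N].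

Lemma grows_le C r r' : (r' <= r)%N -> grows C r -> grows C r'.
Proof.
move=> le [D h]; exists D => J J0; have [X [s [h1 h2 h3]]] := h J J0.
by exists X, s; split=> //; apply: leq_trans h3; apply: leq_pexp2l.
Qed.

Lemma msize_mul_le (f g : S) : (msize (f * g) <= (msize f + msize g).-1)%N.
Proof.
have [->|f0] := eqVneq f 0; first by rewrite mul0r msize0.
have [->|g0] := eqVneq g 0; first by rewrite mulr0 msize0.
by rewrite msizeM.
Qed.

Lemma msize_expM_le (f g : S) a : (msize (f ^+ a * g) <= a * msize f + msize g)%N.
Proof.
elim: a => [|a IH]; first by rewrite expr0 mul1r.
rewrite exprS -mulrA mulSn -addnA.
by apply: leq_trans (msize_mul_le _ _) _; apply: leq_trans (leq_pred _) _; rewrite leq_add2l.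
Qed.

(* [f] is a nonzerodivisor modulo [C] and vanishes modulo [C'], so multiplying a family that is
   independent modulo [C'] by the powers of [f] keeps it independent modulo [C]. *)
Lemma grows_step C C' r f : prime_ideal C -> prime_ideal C' -> {subset C <= C'} ->
  f \in C' -> f \notin C -> grows C' r -> grows C r.+1.
Proof.
move=> [[C0 C1 Ccl] Cpr] [[C'0 C'1 C'cl] _] sub fC' fC [D h].
exists (D + msize f)%N => J J0; have [X [s [fr sz card]]] := h J J0.
exists ('I_J * X)%type, (fun y : 'I_J * X => f ^+ y.1 * s y.2); split; last 2 first.
- move=> [a x] /=; apply: leq_trans (msize_expM_le _ _ _) _.
  have := sz x; have := ltn_ord a; nia.
- by rewrite card_prod card_ord expnS leq_mul2l card orbT.
suff H m (la : nat -> X -> k) : \sum_(a < m) \sum_x la a x *: (f ^+ a * s x) \in C ->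
    forall a x, (a < m)%N -> la a x = 0.
  move=> la hs [a x]; have {hs} : \sum_(b < J) \sum_y la (b, y) *: (f ^+ b * s y) \in C.
    by rewrite pair_bigA /=; under eq_bigr => y _ do rewrite -surjective_pairing.
  pose la' b x := if insub b is Some b' then la (b', x) else 0.
  have lE (b : 'I_J) y : la' b y = la (b, y) by rewrite /la' valK.
  move=> hs; rewrite -lE; apply: (H J) => //; move: hs; congr (is_true (_ \in C)).
  by apply: eq_bigr => b _; apply: eq_bigr => y _; rewrite lE.
elim: m la => // m IH la; rewrite big_ord_recl.
set q := \sum_(a < m) \sum_x la a.+1 x *: (f ^+ a * s x).
have -> : \sum_(i < m) \sum_x la (lift ord0 i) x *: (f ^+ lift ord0 i * s x) = f * q.
  rewrite mulr_sumr; apply: eq_bigr => a _; rewrite mulr_sumr; apply: eq_bigr => x _.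
  by rewrite /= exprS -mulrA scalerAr.
under eq_bigr => x _ do rewrite expr0 mul1r.
move=> hC; have la0 : forall x, la 0%N x = 0.
  apply: fr; have := sub _ hC; set w := \sum_x _ => hC'.
  have fqC' : f * q \in C' by rewrite mulrC -[_ * _]addr0 C'cl.
  have -> : w = - 1 * (f * q) + (w + f * q) by rewrite mulN1r addrC addrK.
  exact: C'cl.
have hq : q \in C.
  have : f * q \in C.
    by move: hC; rewrite big1 ?add0r // => x _; rewrite la0 scale0r.
  by move/Cpr; rewrite (negPf fC).
case=> [|a] x; first by rewrite la0.
by rewrite ltnS => am; apply: (IH (fun b y => la b.+1 y) hq).
Qed.

Lemma grows_bound C r : 0 \in C -> grows C r -> (r <= n)%N.
Proof.
move=> C0 gr; rewrite leqNgt; apply/negP => nr.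
(* For this [J], (D J + 1)^n <= (D + 1)^n J^n < J^(n+1). *)
have [D h] := grows_le nr gr; pose J := ((D.+1) ^ n).+1.
have [X [s [fr sz card]]] := h J isT.
pose Y : finType := {ffun 'I_n -> 'I_(D * J).+1}.
have [|la [[x lax] la0]] := @linear_dependency k X Y
    (fun x y => (s x)@_[multinom (y i : nat) | i < n]).
  apply: leq_trans card; rewrite card_ffun !card_ord.
  have le : ((D * J).+1 <= D.+1 * J)%N by rewrite /J; lia.
  apply: leq_ltn_trans (leq_expl _ le) _.
  by rewrite expnMn expnSr mulnC ltn_pmul2l ?expn_gt0.
suff e : \sum_x la x *: s x = 0 by move: lax; rewrite (fr la) ?eqxx // e.
apply/mpolyP => m; rewrite mcoeff0 raddf_sum /=.
under eq_bigr => y _ do rewrite mcoeffZ.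
have [mD|mD] := leqP (mdeg m) (D * J); last first.
  apply: big1 => y _; rewrite memN_msupp_eq0 ?mulr0 //; apply: msize_mdeg_ge.
  exact: leq_trans (sz y) mD.
have mi i : (m i < (D * J).+1)%N.
  by rewrite ltnS; apply: leq_trans mD; rewrite mdegE (bigD1 i) //= leq_addr.
rewrite -[RHS](la0 [ffun i => Ordinal (mi i)]); apply: eq_bigr => y _.
by congr (_ * _@__); apply/mnmP => i; rewrite mnmE ffunE.
Qed.

Definition supported_in (T : {set 'I_n}) (g : S) :=
  forall m, m \in msupp g -> forall i, i \notin T -> m i = 0%N.

(** The monomials in the variables of [T] with exponents at most J are independent modulo [P], and
    their degree is at most n J. *)
Lemma grows_supported P (T : {set 'I_n}) :
  (forall g, g \in P -> supported_in T g -> g = 0) -> grows P #|T|.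
Proof.
move=> hP; exists n => J J0.
pose X : finType := {y : {ffun 'I_n -> 'I_J.+1} | y \in pffun_on ord0 T predT}.
pose mon (y : X) : 'X_{1..n} := [multinom (val y i : nat) | i < n].
have mon_inj : injective mon.
  move=> y y' /mnmP e; apply/val_inj/ffunP => i; apply/val_inj.
  by have := e i; rewrite !mnmE.
have mcf la y : (\sum_(x : X) la x *: 'X_[mon x] : S)@_(mon y) = la y.
  rewrite raddf_sum (bigD1 y) //= mcoeffZ mcoeffX eqxx mulr1 big1 ?addr0 // => x xy.
  by rewrite mcoeffZ mcoeffX (inj_eq mon_inj) (negPf xy) mulr0.
exists X, (fun y => 'X_[mon y]); split.
- move=> la hla y; rewrite -(mcf la y) (hP _ hla) ?mcoeff0 //.
  move=> m /msupp_sum_le/flatten_mapP[x _ /msuppZ_le]; rewrite msuppX inE => /eqP-> i iT.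
  rewrite mnmE; have /pffun_onP[/subsetP sT _] := valP x.
  by apply/eqP; apply: contraNT iT => h; apply: sT; rewrite inE; apply: contraNneq h => ->.
- move=> y; rewrite msizeX ltnS mdegE; apply: (@leq_trans (\sum_(i < n) J)).
    by apply: leq_sum => i _; rewrite mnmE -ltnS ltn_ord.
  by rewrite sum_nat_const card_ord.
rewrite card_sig; have := card_pffun_on (ord0 : 'I_J.+1) (mem T) predT.
rewrite cardT size_enum_ord => e; apply: (@leq_trans (J.+1 ^ #|T|)).
  exact: leq_expl.
by rewrite -e; apply/eq_leq/eq_card => y; rewrite !inE.
Qed.

(** Each step down the chain raises the growth exponent by one, and at the bottom it is at most
    [n]. *)
Lemma grows_chain P c r : prime_height_ge P c -> grows P r -> (r + c <= n)%N.
Proof.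
move=> [C [Cpr Cstep CP]] gP.
have g i : (i <= c)%N -> grows (C (c - i)%N) (r + i).
  elim: i => [|i IH] ic.
    rewrite subn0 addn0; have [D h] := gP; exists D => J /h[X [s [h1 h2 h3]]].
    by exists X, s; split=> // la hla; apply: h1; rewrite -CP.
  have e : (c - i = (c - i.+1).+1)%N by lia.
  have lt : (c - i.+1 < c)%N by lia.
  have [sub [f f1 f2]] := Cstep _ lt; rewrite addnS.
  apply: (grows_step (C' := C (c - i)%N) (f := f)); rewrite ?e //.
  - by apply: Cpr; lia.
  - by apply: Cpr; lia.
  by rewrite -e; apply: IH; lia.
have := g c (leqnn c); rewrite subnn; apply: grows_bound.
by have [[]] := Cpr 0%N isT.
Qed.

Lemma prime_avoiding I (W : S -> Prop) : idealr_closed I -> W 1 ->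
  (forall f g, W f -> W g -> W (f * g)) -> (forall f, f \in I -> ~ W f) ->
  exists P, [/\ prime_ideal P, {subset I <= P} & forall f, f \in P -> ~ W f].
Proof.
move=> [I0 I1 Icl] W1 WM IW.
pose good (A : S -> Prop) := [/\ forall f, f \in I -> A f,
  forall a f g, A f -> A g -> A (a * f + g) & forall f, A f -> ~ W f].
pose ok (A : S -> Prop) := (forall f, ~ A f) \/ good A.
have gI : good (fun f => f \in I) by split=> // a f g; apply: Icl.
have [|A [okA maxA]] := @classical_sets.Zorn_bigcup S ok.
  move=> Fam sub tot.
  have [[B FB [f0 Bf0]]|nB] := pselect (exists2 B, Fam B & exists f, B f); last first.
    by left=> f [B FB Bf]; apply: nB; exists B => //; exists f.
  have okE B' f : Fam B' -> B' f -> good B' 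
    by move=> FB' Bf; case: (sub _ FB') => [h|//]; case: (h f Bf).
  right; have gB := okE _ _ FB Bf0; split.
  - by move=> f fI; exists B => //; case: gB => h _ _; apply: h.
  - move=> a f g [B1 F1 f1] [B2 F2 g2].
    have [s12|s21] := tot _ _ F1 F2.
      by exists B2 => //; have [_ h _] := okE _ _ F2 g2; apply: h => //; apply: s12.
    by exists B1 => //; have [_ h _] := okE _ _ F1 f1; apply: h => //; apply: s21.
  by move=> f [B1 F1 f1]; have [_ _ h] := okE _ _ F1 f1; apply: h.
have {okA} gA : good A.
  case: okA => // nA; case: (maxA (fun f => f \in I)); last by right.
  by split=> [f /nA //|/(_ 0 I0)]; apply: nA.
have [AI Acl AW] := gA.
exists (fun f : S => `[< A f >]); split; last by move=> f /asboolP/AW.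
  split.
    split; first by apply/asboolP/AI.
      by apply/negP => /asboolP/AW; apply.
    by move=> a f g /asboolP Af /asboolP Ag; apply/asboolP/Acl.
  have A0 : A 0 by apply: AI.
  have ext f : ~ A f -> exists a p, A p /\ W (p + a * f).
    move=> nAf; apply: contrapT => nW.
    apply: (maxA (fun g => exists a p, A p /\ g = p + a * f)).
      split=> [g Ag|/(_ f)]; first by exists 0, g; rewrite mul0r addr0.
      by move=> h; apply: nAf; apply: h; exists 1, 0; rewrite mul1r add0r.
    right; split.
    - by move=> g gin; exists 0, g; rewrite mul0r addr0; split=> //; apply: AI.
    - move=> b g h [a1 [p1 [Ap1 ->]]] [a2 [p2 [Ap2 ->]]].
      exists (b * a1 + a2), (b * p1 + p2); split; [exact: Acl|ring].
    by move=> g [a [p [Ap ->]]] Wg; apply: nW; exists a, p.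
  move=> f g /asboolP Afg; apply/orP; rewrite -!topredE /=.
  have [Af|/ext[a [p [Ap Wf]]]] := pselect (A f); first by left; apply/asboolP.
  have [Ag|/ext[a' [p' [Ap' Wg]]]] := pselect (A g); first by right; apply/asboolP.
  exfalso; apply: (AW _ _ (WM _ _ Wf Wg)).
  have -> : (p + a * f) * (p' + a' * g) =
      (p' + a' * g) * p + ((a * f) * p' + ((a * a') * (f * g) + 0)) by ring.
  by do 3 (apply: (Acl) => //).
by move=> f fI; apply/asboolP/AI.
Qed.

(** If [I] had no nonzero element in the variables of [T], some prime containing [I] would avoid all
    nonzero polynomials in them. It has height at least [c] and growth #|T|, so [grows_chain] gives
    #|T| + c <= n. *)
Lemma height_dependency I c : idealr_closed I -> has_height I c -> (c <= n)%N /\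
  forall T : {set 'I_n}, (n < #|T| + c)%N ->
    exists g, [/\ g \in I, g != 0 & supported_in T g].
Proof.
move=> hI [hall [P [[[P0 P1 Pcl] _] _ Pc _]]]; split.
  apply: (@grows_chain P c 0) => //; exists 0%N => J _; exists unit, (fun=> 1); split.
  - move=> la; rewrite (big_pred1 tt) => [hla []|[] //].
    apply/eqP; apply: contraNT P1 => l0.
    have -> : 1 = (la tt)^-1%:MP * (la tt *: 1) + 0 :> S.
      by rewrite addr0 mul_mpolyC scalerA mulVf // scale1r.
    exact: Pcl.
  - by move=> _; rewrite msize1.
  by rewrite expn0 card_unit.
move=> T nT; apply: contrapT => nog.
have noI g : g \in I -> supported_in T g -> g = 0.
  move=> gI gT; apply/eqP; apply: contraT => g0; case: nog; by exists g.
have [|||Q [Qpr IQ QW]] := @prime_avoiding I (fun g => g != 0 /\ supported_in T g) hI.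
- by split=> [|m]; rewrite ?oner_eq0 // msupp1 inE => /eqP-> i _; rewrite mnm0E.
- move=> f g [f0 fT] [g0 gT]; split; first by rewrite mulf_neq0.
  move=> m /msuppM_le/allpairsP[[a b] /= [ha hb ->]] i iT.
  by rewrite mnmDE (fT _ ha) // (gT _ hb).
- by move=> f fI [f0 /(noI _ fI) e]; rewrite e eqxx in f0.
have : (#|T| + c <= n)%N.
  apply: (grows_chain (hall Q Qpr IQ)); apply: grows_supported => g gQ gT.
  by apply/eqP; apply: contraT => g0; case: (QW g gQ).
by rewrite leqNgt nT.
Qed.

End Growth.

(** * Standard monomials and algebraic dependency *)

Section StandardMonomials.
Local Open Scope ring_scope.
Variables (k : fieldType) (n e : nat).
Local Notation S := {mpoly k[n]}.
Variable I : {pred S}.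
Hypothesis hI : idealr_closed I.
Hypothesis hdep : forall T : {set 'I_n}, (e < #|T|)%N ->
  exists g, [/\ g \in I, g != 0 & supported_in T g].

Definition standard B (m : 'X_{1..n}) := (#|[set i | (B <= m i)%N]| <= e)%N.

Lemma mlead_lt (q : S) m : q != 0 -> (forall m', m' \in msupp q -> (m' <= m)%O) ->
  q@_m = 0 -> (mlead q < m)%O.
Proof.
move=> q0 le qm; have ml := mlead_supp q0; rewrite lt_neqAle le // andbT.
by apply: contraTneq ml => ->; rewrite mcoeff_msupp qm eqxx.
Qed.

(** A monomial with more than [e] exponents above [B] is divisible by the leading monomial of the
    element of [I] supported on those variables. Sizes do not grow because the monomial order
    refines the degree. *)
Lemma standard_reduction : exists B, forall f, exists h, [/\ f - h \in I,
  (msize h <= msize f)%N & forall m, m \in msupp h -> standard B.+1 m].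
Proof.
have [I0 _ Icl] := hI.
have /choice[g hg] : forall T : {set 'I_n}, exists g, (e < #|T|)%N ->
    [/\ g \in I, g != 0 & supported_in T g].
  by move=> T; have [/hdep[g hg]|_] := boolP (e < #|T|)%N; [exists g|exists 0].
pose B := \max_(T : {set 'I_n}) mdeg (mlead (g T)).
exists B; elim/mleadrect => f IH; have [->|f0] := eqVneq f 0.
  by exists 0; split=> [||m]; rewrite ?subrr ?msupp0.
set m := mlead f in IH.
have red (u : S) c : (forall m', m' \in msupp u -> (m' <= m)%O) -> u@_m = 1 ->
    c = f@_m -> let q := f - c *: u in
    q = 0 \/ [/\ q != 0, (mlead q < m)%O & (msize q <= msize f)%N].
  move=> hu um -> q; have [->|q0] := eqVneq q 0; [by left|right].
  have lt : (mlead q < m)%O.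
    apply: mlead_lt => // [m' /msuppB_le|]; last first.
      by rewrite mcoeffB mcoeffZ um mulr1 subrr.
    by rewrite mem_cat => /orP[/msupp_le_mlead //|/msuppZ_le/hu].
  by split=> //; rewrite -!mlead_deg // ltnS; apply/lemc_mdeg/ltW.
have [st|nst] := boolP (standard B.+1 m).
  have [|||q0|[q0 lt sz]] := red 'X_[m] f@_m.
  - by move=> m'; rewrite msuppX inE => /eqP->.
  - by rewrite mcoeffX eqxx.
  - by [].
  - exists (f@_m *: 'X_[m]); split; first by rewrite q0.
    + by apply: leq_trans (msizeZ_le _ _) _; rewrite msizeX mlead_deg.
    by move=> m' /msuppZ_le; rewrite msuppX inE => /eqP->.
  have [h [h1 h2 h3]] := IH _ lt; exists (h + f@_m *: 'X_[m]); split.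
  - by rewrite opprD addrA addrAC.
  - apply: leq_trans (msizeD_le _ _) _; rewrite geq_max (leq_trans h2 sz) /=.
    by apply: leq_trans (msizeZ_le _ _) _; rewrite msizeX mlead_deg.
  move=> m' /msuppD_le; rewrite mem_cat => /orP[/h3 //|/msuppZ_le].
  by rewrite msuppX inE => /eqP->.
set T := [set i | (B.+1 <= m i)%N] in nst; rewrite -ltnNge -/T in nst.
have [gI g0 gT] := hg T nst; set L := mlead (g T).
have Lm : (L <= m)%MM.
  apply/mnm_lepP => i; have [iT|iT] := boolP (i \in T); last first.
    by rewrite (gT _ (mlead_supp g0) _ iT).
  move: iT; rewrite inE => /ltnW; apply: leq_trans.
  apply: leq_trans (_ : mdeg L <= _)%N; first by rewrite mdegE (bigD1 i) //= leq_addr.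
  exact: (leq_bigmax (F := fun T => mdeg (mlead (g T)))).
pose u := ((g T)@_L)^-1 *: ('X_[m - L] * g T).
have gL0 : (g T)@_L != 0 by rewrite mleadc_eq0.
have Xg0 : 'X_[m - L] * g T != 0.
  by rewrite mulf_neq0 // -msupp_eq0 msuppX.
have [|||q0|[q0 lt sz]] := red u f@_m.
- move=> m' /msuppZ_le/msupp_le_mlead; rewrite mleadM // ?mleadXm -?msupp_eq0 ?msuppX //.
  by rewrite submK.
- rewrite mcoeffZ [_ * g T]mulrC mcoeffMXle lem_subr.
  have -> : (m - (m - L))%MM = L.
    by apply/mnmP => i; have /mnm_lepP/(_ i) := Lm; rewrite !mnmBE; lia.
  by rewrite mulVf.
- by [].
- have uI : f \in I.
    have -> : f = (f@_m * ((g T)@_L)^-1)%:MP * 'X_[m - L] * g T + 0.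
      rewrite addr0 -mulrA mul_mpolyC -scalerA.
      by apply/eqP; rewrite -subr_eq0; apply/eqP.
    exact: Icl.
  by exists 0; split=> [||m']; rewrite ?subr0 ?msupp0 // msize0.
have [h [h1 h2 h3]] := IH _ lt; exists h; split=> //; last exact: leq_trans h2 sz.
have -> : f - h = (f@_m * ((g T)@_L)^-1)%:MP * 'X_[m - L] * g T + (f - f@_m *: u - h).
  by rewrite -mulrA mul_mpolyC -scalerA -/u addrAC addrCA subrr addr0.
exact: Icl.
Qed.

(** The set of large exponents, the small ones, and the large ones padded to an [e]-tuple. The
    coding is redundant but covers every standard monomial of degree at most [N], with a count of
    order N^e. *)
Definition std_index B N : finType :=
  ({set 'I_n} * {ffun 'I_n -> 'I_B.+1} * e.-tuple 'I_N.+1)%type.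

Definition std_mon B N (y : std_index B N) : 'X_{1..n} :=
  [multinom if i \in y.1.1 then nth 0%N (map val y.2) (index i (enum y.1.1)) else y.1.2 i : nat
   | i < n].

Lemma std_monP B N m : standard B.+1 m -> (mdeg m <= N)%N ->
  exists y : std_index B N, std_mon y = m.
Proof.
move=> st mN; pose U := [set i | (B.+1 <= m i)%N].
have szU : (size (enum U) <= e)%N by rewrite -cardE.
have mi i : (m i <= N)%N by apply: leq_trans mN; rewrite mdegE (bigD1 i) //= leq_addr.
pose l : e.-tuple 'I_N.+1 := [tuple inord (nth 0%N [seq m i | i <- enum U] j) | j < e].
exists (U, [ffun i => inord (m i)], l); apply/mnmP => i; rewrite mnmE /=.
case: ifP => iU; last first.
  by rewrite ffunE inordK // ltnNge; move: iU; rewrite inE => ->.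
have idx : (index i (enum U) < size (enum U))%N by rewrite index_mem mem_enum.
have idx' := leq_trans idx szU.
have E (j : 'I_e) : nth 0%N [seq val x | x <- l] j =
    inord (n' := N) (nth 0%N [seq m i | i <- enum U] j).
  by rewrite (nth_map ord0) ?size_tuple // -(tnth_nth ord0 l j) tnth_mktuple.
rewrite (E (Ordinal idx')) /= (nth_map i) // nth_index ?mem_enum //.
by rewrite inordK // ltnS.
Qed.

Lemma card_std_index B N : #|std_index B N| = (2 ^ n * B.+1 ^ n * N.+1 ^ e)%N.
Proof.
rewrite !card_prod card_tuple card_ffun !card_ord; congr (_ * _ * _)%N.
have := card_powerset [set: 'I_n]; rewrite cardsT card_ord => <-.
by apply: eq_card => A; rewrite !inE subsetT.
Qed.

End StandardMonomials.

Section HomogeneousComposition.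
Local Open Scope ring_scope.
Variables (K : comNzRingType) (r n : nat) (z : r.-tuple {mpoly K[n]}).

Lemma dhomog_msize_le D (p : {mpoly K[n]}) : p \is D.-homog -> (msize p <= D.+1)%N.
Proof.
move=> hp; rewrite msizeE; apply/bigmax_leqP_seq => m ms _.
by rewrite (dhomog_mf hp ms).
Qed.

Hypothesis hz : forall i, tnth z i \is 1.-homog.

Lemma dhomog_comp_X m : 'X_[m] \mPo z \is (mdeg m).-homog.
Proof.
rewrite comp_mpolyX mdegE.
apply: (big_ind2 (fun (p : {mpoly K[n]}) D => p \is D.-homog)) => [|p u q v|i _].
- exact: dhomog1.
- exact: dhomogM.
by have := dhomogMn (m i) (hz i); rewrite mul1n.
Qed.

Lemma pihomog_comp D (g : {mpoly K[r]}) :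
  pihomog mdeg D (g \mPo z) = pihomog mdeg D g \mPo z.
Proof.
elim/mpolyind: g => [|a m p _ _ IH]; first by rewrite !(pihomog0, comp_mpoly0).
rewrite [in LHS]linearP linearP /= IH [in RHS]linearP /= pihomogX.
rewrite [in RHS]linearP /=; congr (_ *: _ + _).
have hX := dhomog_comp_X m; have [e|ne] := eqVneq (mdeg m) D.
  by rewrite pihomog_dE // -e.
by rewrite comp_mpoly0 (@pihomog_ne0 _ _ _ (mdeg m) D).
Qed.

End HomogeneousComposition.

Lemma map_mpoly_homog (k K : fieldType) (io : {rmorphism k -> K}) n d (f : {mpoly k[n]}) :
  f \is d.-homog -> map_mpoly io f \is d.-homog.
Proof.
move=> hf; apply/dhomogP => m; rewrite mcoeff_msupp mcoeff_map_mpoly => fm.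
apply: (dhomog_mf hf); rewrite mcoeff_msupp; apply: contraNneq fm => /= e0.
by rewrite e0 rmorph0.
Qed.

(** * Extended ideals and relations between linear forms *)

Section ExtendedIdeal.
Local Open Scope ring_scope.
Variables (R R' : comNzRingType) (th : R -> R') (I : {pred R}).

Definition extended (h : R') :=
  exists s : seq (R' * R), (forall x, x \in s -> x.2 \in I) /\ h = \sum_(x <- s) x.1 * th x.2.

Lemma extended0 : extended 0.
Proof. by exists [::]; split=> //; rewrite big_nil. Qed.

Lemma extendedD f g : extended f -> extended g -> extended (f + g).
Proof.
move=> [s [hs ->]] [t [ht ->]]; exists (s ++ t); split; last by rewrite big_cat.
by move=> x; rewrite mem_cat => /orP[/hs|/ht].
Qed.

Lemma extendedM a f : extended f -> extended (a * f).
Proof.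
move=> [s [hs ->]]; exists [seq (a * x.1, x.2) | x <- s]; split.
  by move=> x /mapP[y /hs hy ->].
by rewrite big_map mulr_sumr; apply: eq_bigr => x _; rewrite mulrA.
Qed.

Lemma extended_sum (X : finType) (F : X -> R') : (forall x, extended (F x)) ->
  extended (\sum_x F x).
Proof. by move=> h; elim/big_ind: _ => //; [apply: extended0|apply: extendedD]. Qed.

Lemma extended_mem f : f \in I -> extended (th f).
Proof.
move=> fI; exists [:: (1, f)]; split; last by rewrite big_seq1 mul1r.
by move=> x; rewrite inE => /eqP->.
Qed.

End ExtendedIdeal.

Section Dependency.
Local Open Scope ring_scope.
Variables (k K : fieldType) (io : {rmorphism k -> K}) (n d c : nat).
Local Notation S := {mpoly k[n]}.
Variable I : {pred S}.
Hypotheses (hI : idealr_closed I) (hgen : generated_in_degree d I) (hht : has_height I c).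

Local Notation IK := (extended (map_mpoly io) I).

Lemma extended_part D h : IK h -> IK (pihomog mdeg D h).
Proof.
move=> [s [hs ->]]; rewrite raddf_sum /= big_seq.
elim/big_ind: _ => [||[a f] xs]; [exact: extended0|exact: extendedD|].
have /hgen[t [ht ->]] := hs _ xs; rewrite /= raddf_sum mulr_sumr raddf_sum big_seq.
elim/big_ind: _ => [||[b g] /ht[gI gd]]; [exact: extended0|exact: extendedD|].
have /shomogP gd' := map_mpoly_homog io gd.
rewrite /= rmorphM mulrA -[pihomog _ _ _]/(hpart D%:Z _) (hpartMr _ _ gd').
by apply/extendedM/extended_mem.
Qed.

(** The J^r monomials in the forms with exponents below J reduce modulo the ideal into a space of
    dimension of order J^(n-c). A linear relation among the reductions is a polynomial relation, of
    which a nonzero graded part is kept. *)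
Lemma algebraic_dependency r (z : r.-tuple {mpoly K[n]}) : (n < r + c)%N ->
  (forall i, tnth z i \is 1.-homog) ->
  exists D (g : {mpoly K[r]}), [/\ g \is D.-homog, g != 0 & IK (g \mPo z)].
Proof.
move=> hr hz; have [cn hdep] := height_dependency hI hht.
have [|B hB] := @standard_reduction k n (n - c) I hI.
  by move=> T hT; apply: hdep; lia.
have /choice[hr' hhr] := hB.
(* Reduction takes place over [k], one monomial at a time, and is extended linearly to [K]; thus it
   draws on the height of [I] and not on that of its extension. *)
pose red (p : {mpoly K[n]}) : {mpoly K[n]} :=
  \sum_(m <- msupp p) p@_m *: map_mpoly io (hr' 'X_[m]).
have redI p : IK (p - red p).
  rewrite {1}[p]mpolyE /red -sumrB.
  elim/big_ind: _ => [||m _]; [exact: extended0|exact: extendedD|].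
  rewrite -scalerBr -mul_mpolyC; apply: extendedM.
  have -> : 'X_[m] = map_mpoly io 'X_[m] by rewrite map_mpolyX.
  by rewrite -rmorphB; apply: extended_mem; case: (hhr 'X_[m]).
have redS p m : m \in msupp (red p) -> standard (n - c) B.+1 m /\ (mdeg m < msize p)%N.
  move/msupp_sum_le/flatten_mapP => [m']; rewrite mem_filter /= => m'p /msuppZ_le mm.
  have mm' : m \in msupp (hr' 'X_[m']).
    move: mm; rewrite !mcoeff_msupp mcoeff_map_mpoly.
    by apply: contraNneq => /= e0; rewrite e0 rmorph0.
  have [_ sz st] := hhr 'X_[m']; split; first exact: st.
  apply: leq_trans (msize_mdeg_lt mm') _; apply: leq_trans sz _.
  by rewrite msizeX; apply: msize_mdeg_lt.
(* J exceeds the constant in 2^n (B+1)^n (r J + 1)^e <= 2^n (B+1)^n (r+1)^e J^e, so the left side is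
   below J^(e+1) <= J^r. *)
pose e := (n - c)%N; pose J := (2 ^ n * B.+1 ^ n * r.+1 ^ e).+1.
pose X : finType := {ffun 'I_r -> 'I_J}.
pose mon (x : X) : 'X_{1..r} := [multinom (x i : nat) | i < r].
have mon_inj : injective mon.
  move=> x x' /mnmP ex; apply/ffunP => i; apply/val_inj.
  by have := ex i; rewrite !mnmE.
pose P x : {mpoly K[n]} := 'X_[mon x] \mPo z.
have szP x : (msize (P x) <= (r * J).+1)%N.
  apply: leq_trans (dhomog_msize_le (dhomog_comp_X hz _)) _; rewrite ltnS mdegE.
  apply: (@leq_trans (\sum_(i < r) J)).
    by apply: leq_sum => i _; rewrite mnmE ltnW.
  by rewrite sum_nat_const card_ord.
pose N := (r * J)%N.
have [|la [[x lax] la0]] := @linear_dependency K X (std_index n e B N)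
    (fun x y => (red (P x))@_(std_mon y)).
  rewrite card_std_index card_ffun !card_ord.
  have leN : (N.+1 <= r.+1 * J)%N by rewrite /N mulSn addnC -addn1 leq_add.
  apply: leq_ltn_trans (_ : _ <= 2 ^ n * B.+1 ^ n * (r.+1 * J) ^ e)%N _.
    by rewrite leq_mul2l leq_expl ?orbT.
  rewrite expnMn mulnA; apply: leq_trans (_ : J * J ^ e <= _)%N.
    by rewrite ltn_pmul2r ?expn_gt0.
  by rewrite -expnS leq_pexp2l // /e; lia.
pose g : {mpoly K[r]} := \sum_x la x *: 'X_[mon x].
have gx y : g@_(mon y) = la y.
  rewrite raddf_sum (bigD1 y) //= mcoeffZ mcoeffX eqxx mulr1 big1 ?addr0 // => x' xy.
  by rewrite mcoeffZ mcoeffX (inj_eq mon_inj) (negPf xy) mulr0.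
have g0 : g@_(mon x) != 0 by rewrite gx.
have gI : IK (g \mPo z).
  have -> : g \mPo z = \sum_y la y *: P y.
    by rewrite raddf_sum; apply: eq_bigr => y _; rewrite /= comp_mpolyZ.
  have s0 : \sum_y la y *: red (P y) = 0.
    apply/mpolyP => m; rewrite mcoeff0 raddf_sum /=.
    under eq_bigr => y _ do rewrite mcoeffZ.
    have [[y1 my1]|nm] := pselect (exists y, std_mon (y : std_index n e B N) = m).
      by rewrite -my1.
    apply: big1 => y _; rewrite memN_msupp_eq0 ?mulr0 //; apply/negP => /redS[st dm].
    case: nm; apply: std_monP => //; rewrite -ltnS; exact: leq_trans dm (szP y).
  have -> : \sum_y la y *: P y = \sum_y (la y)%:MP * (P y - red (P y)).
    under [RHS]eq_bigr => y _ do rewrite mul_mpolyC scalerBr.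
    by rewrite sumrB s0 subr0.
  by apply: extended_sum => y; apply: extendedM.
exists (mdeg (mon x)), (pihomog mdeg (mdeg (mon x)) g); split.
- exact: pihomogP.
- apply: contraNneq g0 => e0; have := mcoeff_pihomog (mdeg (mon x)) g (mon x).
  by rewrite e0 eqxx mcoeff0 => <-.
by rewrite -pihomog_comp //; apply: extended_part.
Qed.

End Dependency.

(** * Zero-dimensional linear sections *)

Section NonvanishingPoint.
Local Open Scope ring_scope.

Lemma digits_inj r B (a b : nat -> nat) :
  (forall i, (i < r)%N -> (a i < B)%N) -> (forall i, (i < r)%N -> (b i < B)%N) ->
  (\sum_(i < r) a i * B ^ i = \sum_(i < r) b i * B ^ i)%N ->
  forall i, (i < r)%N -> a i = b i.
Proof.
elim: r a b => // r IH a b ha hb; rewrite !big_ord_recl !expn0 !muln1.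
have B0 : (0 < B)%N by have := ha 0%N isT; lia.
have E (f : nat -> nat) : (\sum_(i < r) f (lift ord0 i) * B ^ lift ord0 i =
    (\sum_(i < r) f i.+1 * B ^ i) * B)%N.
  by rewrite big_distrl; apply: eq_bigr => i _; rewrite /= /bump /= add1n expnSr mulnA.
rewrite !E => e.
have e0 : a 0%N = b 0%N.
  have := congr1 (modn^~ B) e.
  by rewrite ![(_ + _ * B)%N]addnC !modnMDl !modn_small ?ha ?hb.
move: e; rewrite /= e0 => /addnI/eqP; rewrite eqn_pmul2r // => /eqP e [//|i] ir.
by apply: (IH (fun i => a i.+1) (fun i => b i.+1)) => // j jr; [apply: ha|apply: hb].
Qed.

(* Kronecker substitution v_i = t^(B^i). *)
Lemma nonvanishing_point (K : fieldType) r (p : {mpoly K[r]}) :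
  (forall N, exists s : seq K, uniq s /\ size s = N) -> p != 0 ->
  exists v : 'I_r -> K, p.@[v] != 0.
Proof.
move=> Kinf p0; pose B := msize p; pose w (m : 'X_{1..r}) := (\sum_(i < r) m i * B ^ i)%N.
have mB (m : 'X_{1..r}) i : m \in msupp p -> (m i < B)%N.
  move/msize_mdeg_lt; apply: leq_ltn_trans.
  by rewrite mdegE (bigD1 i) //= leq_addr.
have w_inj m m' : m \in msupp p -> m' \in msupp p -> w m = w m' -> m = m'.
  move=> hm hm' e; apply/mnmP => i.
  pose ext (u : 'X_{1..r}) j := if insub j is Some i' then u i' else 0%N.
  have extE u (i' : 'I_r) : ext u i' = u i' by rewrite /ext valK.
  rewrite -!extE; apply: (@digits_inj r B) (ltn_ord i) => [j jr|j jr|].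
  - by rewrite (extE _ (Ordinal jr)) mB.
  - by rewrite (extE _ (Ordinal jr)) mB.
  by move: e; rewrite /w => e; rewrite (eq_bigr _ (fun i _ => congr1 (fun x => x * _)%N (extE m i)))
     (eq_bigr _ (fun i _ => congr1 (fun x => x * _)%N (extE m' i))).
pose P : {poly K} := \sum_(m <- msupp p) p@_m *: 'X^(w m).
have P0 : P != 0.
  have m0 := mlead_supp p0; apply: contraNneq p0 => e; rewrite -mleadc_eq0.
  have <- : P`_(w (mlead p)) = p@_(mlead p); last by rewrite e coef0.
  rewrite coef_sum (big_rem _ m0) /= coefZ coefXn eqxx mulr1 big1_seq ?addr0 // => m /= hm.
  rewrite coefZ coefXn; case: eqP => [e'|]; last by rewrite mulr0.
  move: hm; rewrite mem_rem_uniq ?msupp_uniq // inE => /andP[/eqP ne hm].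
  by case: ne; apply: w_inj.
(* [size P] is one more than the degree, too many for all these elements to be roots. *)
have [s [us sz]] := Kinf (size P).
have [t ts Pt] : exists2 t, t \in s & ~~ root P t.
  apply/allPn; apply/negP => al; have := max_poly_roots P0 al us.
  by rewrite sz ltnn.
exists (fun i => t ^+ (B ^ i)); apply: contraNneq Pt => e; apply/rootP.
rewrite -e mevalE horner_sum; apply: eq_bigr => m _.
rewrite hornerZ hornerXn; congr (_ * _); rewrite -prodrXr.
by apply: eq_bigr => i _; rewrite -exprM mulnC.
Qed.

End NonvanishingPoint.

Section Parametrization.
Local Open Scope ring_scope.
Variables (k K : fieldType) (io : {rmorphism k -> K}) (n d c : nat).
Local Notation S := {mpoly k[n]}.
Variable I : {pred S}.
Hypotheses (hI : idealr_closed I) (hgen : generated_in_degree d I) (hht : has_height I c).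
Hypothesis Kinf : forall N, exists s : seq K, uniq s /\ size s = N.

Definition linear_forms p q (A : 'M[K]_(p, q)) : p.-tuple {mpoly K[q]} :=
  [tuple \sum_j A i j *: 'X_j | i < p].

Lemma linear_forms_homog p q (A : 'M[K]_(p, q)) i : tnth (linear_forms A) i \is 1.-homog.
Proof.
by rewrite tnth_mktuple; apply: rpred_sum => j _; apply: rpredZ; rewrite dhomogX /= mdeg1.
Qed.

Lemma linear_forms_comp p q r (A : 'M[K]_(p, q)) (B : 'M[K]_(q, r)) i :
  tnth (linear_forms A) i \mPo linear_forms B = tnth (linear_forms (A *m B)) i.
Proof.
rewrite !tnth_mktuple raddf_sum /=.
under eq_bigr => j _ do rewrite comp_mpolyZ comp_mpolyXU -tnth_nth tnth_mktuple scaler_sumr.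
rewrite exchange_big; apply: eq_bigr => l _; rewrite mxE scaler_suml.
by apply: eq_bigr => j _; rewrite scalerA.
Qed.

Lemma comp_mpolyA p q r (f : {mpoly K[p]}) (s : p.-tuple {mpoly K[q]})
    (t : q.-tuple {mpoly K[r]}) :
  (f \mPo s) \mPo t = f \mPo [tuple tnth s i \mPo t | i < p].
Proof.
elim/mpolyind: f => [|a m f _ _ IH]; first by rewrite !comp_mpoly0.
rewrite !comp_mpolyD !comp_mpolyZ IH; congr (_ *: _ + _).
rewrite !comp_mpolyX rmorph_prod; apply: eq_bigr => i _.
by rewrite rmorphXn /= tnth_mktuple.
Qed.

Definition param q (T : 'M[K]_(n, q)) (f : S) : {mpoly K[q]} :=
  map_mpoly io f \mPo linear_forms T.

Lemma extended_comp q (T : 'M[K]_(n, q)) h :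
  extended (map_mpoly io) I h -> extended (param T) I (h \mPo linear_forms T).
Proof.
move=> [s [hs ->]]; exists [seq (x.1 \mPo linear_forms T, x.2) | x <- s]; split.
  by move=> x /mapP[y /hs hy ->].
by rewrite big_map raddf_sum; apply: eq_bigr => x _; rewrite /= rmorphM.
Qed.

(** Geometrically, the linear section given by [T] meets the zero set of [I] at most in the
    origin. *)
Definition zero_dim q (T : 'M[K]_(n, q)) :=
  exists N, forall j, extended (param T) I ('X_j ^+ N).

(* The linear forms [Z] vanishing on the columns of [T] satisfy a homogeneous relation [g]
   modulo [I].  If [v] is a point where g(Z) does not vanish, then g(Z) restricts to a nonzero
   multiple of a power of the new variable. *)
Lemma zero_dim_step q (T : 'M[K]_(n, q)) : (q < c)%N -> zero_dim T ->
  exists v, zero_dim (row_mx T v : 'M_(n, q + 1)).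
Proof.
move=> qc [N hN]; pose Z := row_base (kermx T).
have rk : (n < \rank (kermx T) + c)%N.
  have := rank_leq_col T; rewrite mxrank_ker; have := rank_leq_row T; lia.
have [D [g [gD g0 gI]]] := algebraic_dependency io hI hgen hht rk (linear_forms_homog Z).
have [a ga] := nonvanishing_point Kinf g0.
have [Zi ZZi] := row_freeP (row_base_free (kermx T)).
(* The rows of [Z] are independent, so a right inverse gives [v] with prescribed values Z v = a. *)
pose v : 'cV_n := Zi *m \col_i a i.
exists v; set T' := row_mx T v; pose y : 'I_(q + 1) := rshift q ord0.
have ZT : Z *m T = 0.
  by apply/eqP; rewrite -sub_kermx eq_row_base.
have ZT' : Z *m T' = row_mx 0 (\col_i a i) by rewrite mul_mx_row ZT mulmxA ZZi mul1mx.
have yD : extended (param T') I ('X_y ^+ D).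
  have E : (g \mPo linear_forms Z) \mPo linear_forms T' = g.@[a] *: 'X_y ^+ D.
    rewrite comp_mpolyA.
    have -> : [tuple tnth (linear_forms Z) i \mPo linear_forms T' | i < \rank (kermx T)] =
        [tuple a i *: 'X_y | i < \rank (kermx T)].
      apply: eq_from_tnth => i; rewrite tnth_mktuple linear_forms_comp ZT' !tnth_mktuple.
      rewrite big_split_ord /= big1 ?add0r => [|j _]; last by rewrite row_mxEl mxE scale0r.
      by rewrite big_ord1 row_mxEr mxE.
    rewrite comp_mpolyE mevalE scaler_suml !big_seq; apply: eq_bigr => m mg.
    rewrite -scalerA; congr (_ *: _); rewrite -(dhomog_mf gD mg) /= mdegE -prodrXr -scaler_prod.
    by apply: eq_bigr => i _; rewrite tnth_mktuple exprZn.
  have -> : 'X_y ^+ D = (g.@[a])^-1%:MP * ((g \mPo linear_forms Z) \mPo linear_forms T').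
    by rewrite E mul_mpolyC scalerA mulVf // scale1r.
  by apply: extendedM; apply: extended_comp.
(* [sg] includes the old variables; [pr] sets the new variable to 0. *)
pose sg : q.-tuple {mpoly K[q + 1]} := [tuple 'X_(lshift 1 j) | j < q].
pose pr : (q + 1).-tuple {mpoly K[q]} :=
  [tuple if split j is inl j' then 'X_j' else 0 | j < q + 1].
have prL j : tnth pr (lshift 1 j) = 'X_j by rewrite tnth_mktuple (unsplitK (inl j)).
have prR : tnth pr y = 0 by rewrite tnth_mktuple (unsplitK (inr ord0)).
have split_y (h : {mpoly K[q + 1]}) : exists h', h = (h \mPo pr) \mPo sg + 'X_y * h'.
  elim/mpolyind: h => [|b m h _ _ [h' IH]]; first by exists 0; rewrite !comp_mpoly0 mulr0 addr0.
  suff [h1 e1] : exists h1, 'X_[m] = ('X_[m] \mPo pr) \mPo sg + 'X_y * h1 :> {mpoly K[q + 1]}.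
    exists (b *: h1 + h'); rewrite !comp_mpolyD !comp_mpolyZ {1}e1 {1}IH scalerDr mulrDr.
    by rewrite -scalerAr addrACA.
  have [my|my] := posnP (m y).
    exists 0; rewrite mulr0 addr0 comp_mpolyX rmorph_prod {1}mpolyXE_id !big_split_ord /=.
    rewrite !big_ord1 -/y my !expr0 rmorph1; congr (_ * _); apply: eq_bigr => j _.
    by rewrite prL rmorphXn /= comp_mpolyXU -tnth_nth tnth_mktuple.
  exists 'X_[m - U_(y)]; rewrite -mpolyXD addmC submK ?lep1mP -?lt0n //.
  rewrite comp_mpolyX big_split_ord /= big_ord1 -/y prR expr0n.
  by rewrite eqn0Ngt my mulr0 comp_mpoly0 add0r.
have pr_param f : param T' f \mPo pr = param T f.
  rewrite /param comp_mpolyA; congr (_ \mPo _); apply: eq_from_tnth => i.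
  rewrite !tnth_mktuple raddf_sum big_split_ord /= big_ord1 -/y.
  rewrite [X in _ + X](_ : _ = 0) ?addr0.
    by apply: eq_bigr => j _; rewrite row_mxEl comp_mpolyZ comp_mpolyXU -tnth_nth prL.
  by rewrite comp_mpolyZ comp_mpolyXU -tnth_nth prR scaler0.
(* For an old variable, X_j^N = w + y h' with w in the extended ideal, so X_j^(N D) is (y h')^D
   modulo w. The summand D lets the same exponent serve for y. *)
exists (N * D + D)%N => j; rewrite -(splitK j); case: (split j) => j' /=; last first.
  by rewrite ord1 exprD; apply: extendedM.
rewrite [(N * D + D)%N]addnC exprD exprM; apply: extendedM.
have [s [hs es]] := hN j'.
pose w : {mpoly K[q + 1]} := \sum_(x <- s) (x.1 \mPo sg) * param T' x.2.
have wE : extended (param T') I w.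
  exists [seq (x.1 \mPo sg, x.2) | x <- s]; split; last by rewrite big_map.
  by move=> x /mapP[x' /hs hx' ->].
have [h' eh'] := split_y ('X_(lshift 1 j') ^+ N - w).
have pr0 : ('X_(lshift 1 j') ^+ N - w) \mPo pr = 0.
  rewrite raddfB /= rmorphXn /= comp_mpolyXU -tnth_nth prL es.
  apply/eqP; rewrite subr_eq0; apply/eqP; rewrite /w (linear_sum (comp_mpoly pr)) /=.
  apply: eq_bigr => x _; rewrite rmorphM /= pr_param comp_mpolyA.
  have -> : [tuple tnth sg i \mPo pr | i < q] = [tuple 'X_i | i < q].
    by apply: eq_from_tnth => i; rewrite !tnth_mktuple comp_mpolyXU -tnth_nth prL.
  by rewrite comp_mpoly_id.
have -> : ('X_(lshift 1 j') ^+ N) ^+ D = h' ^+ D * 'X_y ^+ D +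
    (\sum_(i < D) ('X_(lshift 1 j') ^+ N) ^+ (D.-1 - i) * ('X_y * h') ^+ i) * w.
  have := subrXX ('X_(lshift 1 j') ^+ N) ('X_y * h') D.
  have -> : 'X_(lshift 1 j') ^+ N - 'X_y * h' = w.
    by move: eh'; rewrite pr0 comp_mpoly0 add0r => <-; rewrite opprB addrC subrK.
  move/eqP; rewrite subr_eq => /eqP ->; rewrite exprMn addrC [_ * h' ^+ D]mulrC; congr (_ + _).
  by rewrite mulrC.
by apply: extendedD; apply: extendedM.
Qed.

Lemma zero_dim_param : exists T : 'M[K]_(n, c), zero_dim T.
Proof.
suff H q : (q <= c)%N -> exists T : 'M[K]_(n, q), zero_dim T by apply: H.
elim: q => [|q IH] qc; first by exists 0, 0%N => -[].
have [T /(zero_dim_step qc)[v hv]] := IH (ltnW qc).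
by rewrite -addn1; exists (row_mx T v).
Qed.

End Parametrization.

(** * The Betti number bound *)

(** Both sides are the trinomial coefficient (p+e)! / (i! (p-i)! e!). *)
Lemma bin_mul_shift p i e : i <= p ->
  'C(p, i) * 'C(p + e, p) = 'C(e + i, i) * 'C(p + e, p - i).
Proof.
move=> ip; have pos : 0 < i`! * (p - i)`! * e`! by rewrite !muln_gt0 !fact_gt0.
apply/eqP; rewrite -(eqn_pmul2r pos); apply/eqP.
have e1 := bin_fact ip; have e2 := @bin_fact (p + e) p (leq_addr _ _).
have e3 := @bin_fact (e + i) i (leq_addl _ _).
have e4 : 'C(p + e, p - i) * ((p - i)`! * (e + i)`!) = (p + e)`!.
  have -> : e + i = p + e - (p - i) by lia.
  by apply: bin_fact; lia.
rewrite addKn in e2; rewrite addnK in e3.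
transitivity (p + e)`!.
  by rewrite -e2 -e1; ring.
by rewrite -e4 -e3; ring.
Qed.

(** [bin_mul_shift] takes a factor independent of p out of each term, and Pascal's rule sums the
    rest. *)
Lemma sum_bin_mul c i e : i < c ->
  \sum_(p < c) 'C(p, i) * 'C(p + e, p) = 'C(e + i, i) * 'C(e + c, c - i.+1).
Proof.
elim: c => // c IH; rewrite ltnS big_ord_recr /= leq_eqVlt => /orP[/eqP <-|ic].
  rewrite big1 => [|p _]; last by rewrite bin_small ?mul0n.
  by rewrite binn mul1n add0n subnn bin0 muln1 addnC.
rewrite IH // (bin_mul_shift _ (ltnW ic)) -mulnDr; congr (_ * _).
have -> : c.+1 - i.+1 = (c - i.+1).+1 by lia.
rewrite addnS binS [c + e]addnC [RHS]addnC; congr (_ + 'C(_, _)); lia.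
Qed.

Lemma fraction_poly_infinite (k : fieldType) N :
  exists s : seq {fraction {poly k}}, uniq s /\ size s = N.
Proof.
exists [seq tofrac ('X^i : {poly k})%R | i <- iota 0 N]; split; last first.
  by rewrite size_map size_iota.
rewrite map_inj_uniq ?iota_uniq // => i j /eqP; rewrite tofrac_eq => /eqP/(congr1 (size \o val)).
by rewrite /= !size_polyXn => -[].
Qed.

Lemma null_homotopic_extended (R R' : comNzRingType) (th : R -> R') (I : {pred R}) c' b
    (D0 : 'cV[R']_(b 0%N)) (D : forall i, 'M[R']_(b i.+1, b i)) h :
  (forall f, f \in I -> null_homotopic c' D0 D (th f)) -> extended th I h ->
  null_homotopic c' D0 D h.
Proof.
move=> H [s [hs ->]]; rewrite big_seq; elim/big_ind: _ => [||x xs].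
- exact: null_homotopic0.
- exact: null_homotopicD.
by apply: null_homotopicM; apply/H/hs.
Qed.

Lemma param_homog (k K : fieldType) (io : {rmorphism k -> K}) n q (T : 'M[K]_(n, q)) d
  (f : {mpoly k[n]}) : f \is d.-homog -> param io T f \is d.-homog.
Proof.
move=> /(map_mpoly_homog io) hg.
rewrite /param -(pihomog_dE hg) -pihomog_comp; first exact: pihomogP.
exact: linear_forms_homog.
Qed.

Theorem corollary3p9 (k : fieldType) (n d c : nat)
    (I : {pred {mpoly k[n]}}) (F : graded_free_seq k n)
    (hd : 1 <= d) (hc : 2 <= c)
    (hI : idealr_closed I)
    (hhom : homogeneous_ideal I)
    (hgen : generated_in_degree d I)
    (hht : has_height I c)
    (hF : graded_free_resolution F I)
    (hN : condition_N F d c) :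
  forall t : nat, 1 <= t <= c ->
    'C(d + t - 2, t - 1) * 'C(d + c - 1, c - t) <= betti F t.
Proof.
(* Here t = i + 1, since [b i] is the rank of M_{i+1}. *)
case: c hc hht hN => // c' c'0 hht hN [//|i]; rewrite /= ltnS => ic.
have [b [D0 [D [hD0 genD0 Dlin bF [ex0 ex]]]]] :=
  linear_strand hd (ltn0Sn c') hI hhom hgen hF hN.
have DD0 : (D 0%N *m D0 = 0)%R.
  apply/row_matrixP => r; rewrite row_mul row0; apply/ex0 => //.
  by exists (delta_mx 0 r)%R; rewrite rowE.
have DD j : j.+1 < c' -> (D j.+1 *m D j = 0)%R.
  move=> jc; apply/row_matrixP => r; rewrite row_mul row0; apply/ex => //.
  by exists (delta_mx 0 r)%R; rewrite rowE.
have hI0 f : f \in I -> null_homotopic c' D0 D f.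
  move=> fI; apply: exact_null_homotopic => //.
  - have /genD0[v ev] := fI; exists v; rewrite ev.
    exact: mx11_scalar.
  - by move=> h u /(ex0 h).
  - by move=> j h u /(ex j h).
pose K : fieldType := {fraction {poly k}}.
pose io : {rmorphism k -> K} := (@tofrac {poly k}) \o (@polyC k).
have [T [N hT]] := zero_dim_param io hI hgen hht (@fraction_poly_infinite k).
pose th : {rmorphism {mpoly k[n]} -> {mpoly K[c'.+1]}} :=
  (comp_mpoly (linear_forms T)) \o (map_mpoly io).
pose E0 := map_mx th D0; pose E j := map_mx th (D j).
(* The summand d + 1 makes the exponent exceed [d], as the dual monomials require. *)
have hX j : null_homotopic c' E0 E ('X_j ^+ (d.+1 + N))%R.
  rewrite exprD; apply: null_homotopicM; apply: null_homotopic_extended (hT j) => f fI.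
  exact: (map_null_homotopic th (hI0 f fI)).
have /choice[s hs] : forall j, exists s : 'rV_(b 0%N) * (forall i, 'M_(b i, b i.+1)),
    [/\ s.1 *m E0 = ('X_j ^+ (d.+1 + N))%:M,
        (0 < c')%N -> s.2 0%N *m E 0%N + E0 *m s.1 = ('X_j ^+ (d.+1 + N))%:M
      & forall i, (i.+1 < c')%N -> s.2 i.+1 *m E i.+1 + E i *m s.2 i = ('X_j ^+ (d.+1 + N))%:M]%R.
  by move=> j; have [s0 [s hs]] := hX j; exists (s0, s).
apply: leq_trans (bF i ic).
have := @sum_bin_le_strand_rank K c' b E0 E c'0.
have -> : 'C(d + i.+1 - 2, i.+1 - 1) * 'C(d + c'.+1 - 1, c'.+1 - i.+1) =
    \sum_(p < c'.+1) 'C(p, i) * 'C(p + d.-1, p).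
  rewrite sum_bin_mul ?ltnS //; congr ('C(_, _) * 'C(_, _)); lia.
move=> H; apply: (H _ _ _ d (d.+1 + N) _ _ _ (fun j => (s j).1) (fun j => (s j).2)) => //.
- move=> j jc r l; rewrite mxE; apply: param_homog; exact: Dlin.
- by rewrite -map_mxM DD0 map_mx0.
- by move=> j jc; rewrite -map_mxM DD // map_mx0.
- by rewrite ltn_addr.
- by move=> r l; rewrite mxE; apply: param_homog.
- by move=> j; have [] := hs j.
- by move=> j; have [_ h _] := hs j; apply: h.
by move=> j x xc; have [_ _ h] := hs j; apply: h.
Qed.
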